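(* Let $d$ and $\partial$ be uniformly locally finite metrics on $\mathbb{N}$, and let $E$ and $F$ be Banach spaces with symmetric bases $\mathcal{E}$ and $\mathcal{F}$, respectively. Assume that all ghost idempotents in $\mathrm{B}_u(d,\mathcal{E})$ and in $\mathrm{B}_u(\partial,\mathcal{F})$ are compact. If $\mathrm{B}_u(d,\mathcal{E})$ and $\mathrm{B}_u(\partial,\mathcal{F})$ are Banach algebra isomorphic, then $(\mathbb{N},d)$ and $(\mathbb{N},\partial)$ are coarsely equivalent.
   Context: All Banach spaces are complex, and ''basis'' means Schauder basis. For a basis $\mathcal{E}=(e_n)_n$ of $E$, $(e_n^* )_n$ denotes the biorthogonal functionals and $\mathcal{L}(E)$ the bounded operators on $E$. Given a metric $d$ on $\mathbb{N}$, $a\in\mathcal{L}(E)$ is a band operator (with respect to $\mathcal{E}$ and $d$) if there is $r>0$ such that $e_m^*(ae_n)=0$ whenever $d(n,m)>r$. $\mathrm{B}_u[d,\mathcal{E}]$ is the algebra of band operators, and the uniform Roe algebra $\mathrm{B}_u(d,\mathcal{E})$ is its operator-norm closure in $\mathcal{L}(E)$. A Banach algebra isomorphism is a bijective algebra homomorphism that is bounded with bounded inverse (not necessarily isometric). An operator $a\in\mathcal{L}(E)$ is a ghost with respect to $\mathcal{E}$ if for all $\varepsilon>0$ there is $n_0\in\mathbb{N}$ such that $|e_m^*(ae_n)|\le\varepsilon$ for all $n,m\ge n_0$. A ghost idempotent is a ghost $a$ with $a^2=a$. A metric $d$ on $\mathbb{N}$ is uniformly locally finite if $\sup_{x\in\mathbb{N}}|B_r(x)|<\infty$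 for all $r>0$, where $B_r(x)$ is the closed ball of radius $r$ about $x$. Two sequences $(x_n)_n,(y_n)_n$ are $\lambda$-equivalent ($\lambda\ge1$) if $\lambda^{-1}\|\sum_{n\le k}\alpha_nx_n\|\le\|\sum_{n\le k}\alpha_ny_n\|\le\lambda\|\sum_{n\le k}\alpha_nx_n\|$ for all $k$ and all scalars, and equivalent if they are $\lambda$-equivalent for some $\lambda$. A basis $(e_n)_n$ is symmetric if it is equivalent to $(e_{\pi(n)})_n$ for all bijections $\pi:\mathbb{N}\to\mathbb{N}$. A map $f:(X,d)\to(Y,\partial)$ is coarse if for all $r>0$ there is $s>0$ such that $d(x,y)<r$ implies $\partial(f(x),f(y))<s$; expanding if for all $s>0$ there is $r>0$ such that $d(x,y)>r$ implies $\partial(f(x),f(y))>s$; a coarse embedding if it is both coarse and expanding; a coarse equivalence if moreover $\sup_{y\in Y}\partial(y,f(X))<\infty$. Two spaces are coarsely equivalent if there is a coarse equivalence between them. *)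

(* Defs.v *)
From HB Require Import structures.
From mathcomp Require Import all_boot all_order all_algebra.
From mathcomp Require Import all_classical all_reals all_analysis.
From mathcomp Require Import complex.

Set Implicit Arguments.
Unset Strict Implicit.
Unset Printing Implicit Defensive.

Import Order.TTheory GRing.Theory Num.Theory.
Import numFieldNormedType.Exports.

Local Open Scope classical_set_scope.
Local Open Scope card_scope.
Local Open Scope ring_scope.

Section Metrics.
Context {R : realType}.

(* A metric is a bare distance function, not the library's metricType, since
   two unrelated metrics live on the same carrier nat. *)
Definition is_metric (X : Type) (d : X -> X -> R) : Prop :=
  [/\ forall x y, 0 <= d x y,
      forall x y, d x y = 0 <-> x = y,
      forall x y, d x y = d y x
    & forall x y z, d x z <= d x y + d y z].

Definition uniformly_locally_finite (X : Type) (d : X -> X -> R) : Prop :=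
  forall r : R, 0 < r ->
    exists N : nat, forall x, [set y | d x y <= r] #<= `I_N.

Definition coarse (X Y : Type) (d : X -> X -> R) (d' : Y -> Y -> R)
    (f : X -> Y) : Prop :=
  forall r : R, 0 < r -> exists2 s : R, 0 < s &
    forall x y, d x y < r -> d' (f x) (f y) < s.

Definition expanding (X Y : Type) (d : X -> X -> R) (d' : Y -> Y -> R)
    (f : X -> Y) : Prop :=
  forall s : R, 0 < s -> exists2 r : R, 0 < r &
    forall x y, d x y > r -> d' (f x) (f y) > s.

Definition coarse_embedding (X Y : Type) (d : X -> X -> R) (d' : Y -> Y -> R)
    (f : X -> Y) : Prop :=
  coarse d d' f /\ expanding d d' f.

Definition dist_to_set (Y : Type) (d' : Y -> Y -> R) (y : Y) (A : set Y) : R :=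
  inf [set d' y z | z in A].

Definition coarse_equivalence (X Y : Type) (d : X -> X -> R)
    (d' : Y -> Y -> R) (f : X -> Y) : Prop :=
  coarse_embedding d d' f /\
  has_ubound [set dist_to_set d' y (range f) | y in [set: Y]].

Definition coarsely_equivalent (X Y : Type) (d : X -> X -> R)
    (d' : Y -> Y -> R) : Prop :=
  exists f : X -> Y, coarse_equivalence d d' f.

End Metrics.

Section Bases.
Context {R : realType}.

(* The norm of a normed space over R[i] takes values in R[i] (in fact in its
   nonnegative reals); rnorm is the same norm, read in R. *)
Definition rnorm (V : normedZmodType R[i]) (x : V) : R := complex.Re `|x|.

Definition expansion (E : normedModType R[i]) (e : nat -> E) (x : E)
    (alpha : nat -> R[i]) : Prop :=
  series (fun n => alpha n *: e n) @ \oo --> x.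

Definition schauder_basis (E : normedModType R[i]) (e : nat -> E) : Prop :=
  forall x : E, exists! alpha : nat -> R[i], expansion e x alpha.

(* coord e m x is e_m^*(x); it is meaningful when e is a Schauder basis. *)
Definition coord (E : normedModType R[i]) (e : nat -> E) (m : nat) (x : E) :
    R[i] :=
  xget (fun=> 0) [set alpha | expansion e x alpha] m.

Definition equivalent_with (E F : normedModType R[i]) (lambda : R)
    (x : nat -> E) (y : nat -> F) : Prop :=
  forall (k : nat) (alpha : nat -> R[i]),
    lambda^-1 * rnorm (\sum_(n < k.+1) alpha n *: x n)
      <= rnorm (\sum_(n < k.+1) alpha n *: y n)
      <= lambda * rnorm (\sum_(n < k.+1) alpha n *: x n).

Definition equivalent_seqs (E F : normedModType R[i])
    (x : nat -> E) (y : nat -> F) : Prop :=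
  exists2 lambda : R, 1 <= lambda & equivalent_with lambda x y.

Definition symmetric_basis (E : normedModType R[i]) (e : nat -> E) : Prop :=
  schauder_basis e /\
  forall p : nat -> nat, bijective p -> equivalent_seqs e (e \o p).

End Bases.

Section Operators.
Context {R : realType}.

(* Operators are plain functions, and subsets of L(E) are sets of functions;
   sums and scalar multiples are pointwise, the product is composition. *)
Definition bounded_operator (E F : normedModType R[i]) (a : E -> F) : Prop :=
  linear a /\ exists M : R, forall x, rnorm (a x) <= M * rnorm x.

(* The operator norm of a; meaningful when a is bounded. *)
Definition opnorm (E F : normedModType R[i]) (a : E -> F) : R :=
  sup [set rnorm (a x) | x in [set x : E | rnorm x <= 1]].

Definition compact_operator (E F : normedModType R[i]) (a : E -> F) : Prop :=
  bounded_operator a /\ precompact (a @` [set x : E | rnorm x <= 1]).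

Definition ghost (E : normedModType R[i]) (e : nat -> E) (a : E -> E) : Prop :=
  bounded_operator a /\
  forall eps : R, 0 < eps -> exists n0 : nat,
    forall m n : nat, (n0 <= m)%N -> (n0 <= n)%N ->
      rnorm (coord e m (a (e n))) <= eps.

Definition ghost_idempotent (E : normedModType R[i]) (e : nat -> E)
    (a : E -> E) : Prop :=
  ghost e a /\ a \o a = a.

Definition band_algebra (E : normedModType R[i]) (d : nat -> nat -> R)
    (e : nat -> E) : set (E -> E) :=
  [set a | bounded_operator a /\
     exists2 r : R, 0 < r &
       forall m n : nat, d n m > r -> coord e m (a (e n)) = 0].

(* The closure of band_algebra d e in L(E) for the operator norm. *)
Definition uniform_roe_algebra (E : normedModType R[i]) (d : nat -> nat -> R)
    (e : nat -> E) : set (E -> E) :=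
  [set a | bounded_operator a /\
     forall eps : R, 0 < eps ->
       exists2 b, band_algebra d e b & opnorm (a \- b) < eps].

(* A and B stand for subalgebras of L(E) and L(F). Only the values of Phi on A
   matter; the last clause bounds the inverse of the bijection A -> B. *)
Definition banach_algebra_iso (E F : normedModType R[i])
    (A : set (E -> E)) (B : set (F -> F)) (Phi : (E -> E) -> (F -> F)) : Prop :=
  [/\ set_bij A B Phi,
      [/\ forall a b, A a -> A b -> Phi (a \+ b) = Phi a \+ Phi b,
          forall (k : R[i]) a, A a -> Phi (k \*: a) = k \*: Phi a
        & forall a b, A a -> A b -> Phi (a \o b) = Phi a \o Phi b],
      exists C : R, forall a, A a -> opnorm (Phi a) <= C * opnorm a
    & exists C : R, forall a, A a -> opnorm a <= C * opnorm (Phi a)].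

Definition banach_algebra_isomorphic (E F : normedModType R[i])
    (A : set (E -> E)) (B : set (F -> F)) : Prop :=
  exists Phi : (E -> E) -> (F -> F), banach_algebra_iso A B Phi.

End Operators.

(* Main.v *)
Require Import Defs.
From HB Require Import structures.
From mathcomp Require Import all_boot all_order all_algebra.
From mathcomp Require Import all_classical all_reals all_analysis.
From mathcomp Require Import complex.
From mathcomp Require Import ring lra zify.

(* An algebra isomorphism [Phi] of the Roe algebras is spatial: rank one
   operators force [Phi a = U a V] with [U : E -> F] bounded and [V] its inverse.
   The [(m, l)] entry of the image of the matrix unit [E_xy] is then
   [f_m^*(U e_x) * e_y^*(V f_l)].

   - For every [n] some entry of the image of [E_nn] is bounded below, uniformly
     in [n].  Otherwise the diagonal idempotent of a sparse infinite set is mapped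
     to a noncompact ghost idempotent.
   - For [d x y <= r] the entries of the image of [E_xy] are small far from the
     diagonal, uniformly in [x] and [y].  Otherwise a gliding hump yields a sparse
     partial translation whose image is not in the Roe algebra.

   Choosing [phi n = m] and [psi n = l] at a large entry of the image of [E_nn],
   the second point shows that [phi] and [psi] are close and [phi] is coarse; the
   same map for the inverse isomorphism is a coarse inverse of [phi].

   That sparse partial translations are bounded needs a symmetric basis to be
   seminormalized and unconditional.  Both follow from a single permutation glued
   from permutations of consecutive blocks on which the bounds fail
   increasingly. *)

Set Implicit Arguments.
Unset Strict Implicit.
Unset Printing Implicit Defensive.

Import Order.TTheory GRing.Theory Num.Theory.
Import numFieldNormedType.Exports.

Local Open Scope classical_set_scope.
Local Open Scope ring_scope.

(* MathComp's [vector] also exports a [coord]. *)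
Local Notation coord := Defs.coord.

(** * Real-valued norms and convergence *)

Section RealNorm.
Context {R : realType}.
Implicit Types V : normedZmodType R[i].

(** In the order of [R[i]] a nonnegative element has zero imaginary part, so every norm estimate can
    be moved to [R] and back. *)
Lemma rnormE V (x : V) : `|x| = (rnorm x)%:C%C.
Proof.
have := normr_ge0 x; rewrite /rnorm lecE => /andP[/eqP/= im0 _].
by case: `|x| im0 => a b /= ->.
Qed.

Lemma rnorm_ge0 V (x : V) : 0 <= rnorm x.
Proof. by have := normr_ge0 x; rewrite rnormE lecR. Qed.

Lemma pos_complexE (z : R[i]) : 0 < z -> exists2 t : R, 0 < t & z = t%:C%C.
Proof.
case: z => a b; rewrite ltcE /= => /andP[/eqP -> a0]; by exists a.
Qed.

Lemma rnorm0 V : rnorm (0 : V) = 0.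
Proof. by rewrite /rnorm normr0. Qed.

Lemma rnorm0_eq0 V (x : V) : rnorm x = 0 -> x = 0.
Proof. by move=> x0; apply/normr0_eq0; rewrite rnormE x0. Qed.

Lemma rnorm_gt0 V (x : V) : x != 0 -> 0 < rnorm x.
Proof.
move=> x0; rewrite lt_def rnorm_ge0 andbT.
by apply: contra_neq x0; exact: rnorm0_eq0.
Qed.

Lemma ler_rnormD V (x y : V) : rnorm (x + y) <= rnorm x + rnorm y.
Proof. by have := ler_normD x y; rewrite !rnormE -rmorphD lecR. Qed.

Lemma rnormN V (x : V) : rnorm (- x) = rnorm x.
Proof. by rewrite /rnorm normrN. Qed.

Lemma ler_rnormB V (x y : V) : rnorm (x - y) <= rnorm x + rnorm y.
Proof. by rewrite -(rnormN y); exact: ler_rnormD. Qed.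

Lemma rdistC V (x y : V) : rnorm (x - y) = rnorm (y - x).
Proof. by rewrite -rnormN opprB. Qed.

Lemma ler_rdistD V (y x z : V) : rnorm (x - z) <= rnorm (x - y) + rnorm (y - z).
Proof. by rewrite -[x - z](subrKA y); exact: ler_rnormD. Qed.

Lemma ler_rnorm_sum V (I : Type) (r : seq I) (P : pred I) (x : I -> V) :
  rnorm (\sum_(i <- r | P i) x i) <= \sum_(i <- r | P i) rnorm (x i).
Proof.
elim/big_ind2 : _ => [|x1 y1 x2 y2 h1 h2|//]; first by rewrite rnorm0.
by apply: le_trans (lerD h1 h2); exact: ler_rnormD.
Qed.

Lemma rnormZ (V : normedModType R[i]) (a : R[i]) (x : V) :
  rnorm (a *: x) = rnorm a * rnorm x.
Proof. by apply: (@complexI R); rewrite rmorphM /= -!rnormE normrZ. Qed.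

Lemma rnormM (a b : R[i]) : rnorm (a * b) = rnorm a * rnorm b.
Proof. by apply: (@complexI R); rewrite rmorphM /= -!rnormE normrM. Qed.

Lemma rnorm1 : rnorm (1 : R[i]) = 1.
Proof. by rewrite /rnorm normr1. Qed.

Lemma rnormV (a : R[i]) : rnorm a^-1 = (rnorm a)^-1.
Proof. by apply: (@complexI R); rewrite fmorphV /= -!rnormE normfV. Qed.

Lemma rnorm_real (t : R) : rnorm (t%:C%C) = `|t|.
Proof. by rewrite /rnorm normc_def /= expr0n addr0 sqrtr_sqr. Qed.

Lemma rnorm_complex (a : R[i]) : rnorm a <= `|complex.Re a| + `|complex.Im a|.
Proof.
rewrite /rnorm normc_def /= -[leRHS]ger0_norm ?addr_ge0//.
rewrite -sqrtr_sqr ler_wsqrtr// sqrrD !real_normK ?num_real//.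
by rewrite lerD2r lerDl mulrn_wge0// mulr_ge0.
Qed.

Lemma Re_le_rnorm (a : R[i]) : `|complex.Re a| <= rnorm a.
Proof.
rewrite /rnorm normc_def /= -sqrtr_sqr ler_wsqrtr//.
by rewrite lerDl sqr_ge0.
Qed.

Lemma Im_le_rnorm (a : R[i]) : `|complex.Im a| <= rnorm a.
Proof.
rewrite /rnorm normc_def /= -sqrtr_sqr ler_wsqrtr//.
by rewrite lerDr sqr_ge0.
Qed.

End RealNorm.

Section Convergence.
Context {R : realType}.

(** Convergence with real tolerances, which keeps all estimates in [R]; [tends_cvg] identifies it
    with filter convergence. *)
Definition tends (V : normedZmodType R[i]) (u : nat -> V) (x : V) : Prop :=
  forall eps : R, 0 < eps ->
    exists N, forall n, (N <= n)%N -> rnorm (u n - x) < eps.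

Lemma eq_tends (V : normedZmodType R[i]) (u v : nat -> V) (x : V) :
  u =1 v -> tends u x -> tends v x.
Proof. by move=> /funext ->. Qed.

Lemma tends_cvg (V : normedModType R[i]) (u : nat -> V) (x : V) :
  u @ \oo --> x <-> tends u x.
Proof.
split=> [/cvgrPdist_lt ux eps eps0|ux].
  have /ux[N _ uN] : 0 < eps%:C%C by rewrite ltcR.
  exists N => n Nn; rewrite rdistC; have := uN n Nn.
  by rewrite /= rnormE ltcR.
apply/cvgrPdist_lt => _ /pos_complexE[eps eps0 ->].
have [N uN] := ux _ eps0.
by exists N => // n /= Nn; rewrite rnormE ltcR rdistC uN.
Qed.

Lemma rcauchy_tends (V : completeNormedModType R[i]) (u : nat -> V) :
  (forall eps : R, 0 < eps -> exists N, forall m n, (N <= m)%N -> (N <= n)%N ->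
     rnorm (u m - u n) < eps) ->
  exists x, tends u x.
Proof.
move=> cu.
have /cauchy_cvgP : cauchy (u @ \oo).
  apply/cauchy_ballP => _ /pos_complexE[eps /cu[N uN] ->].
  rewrite near_map2; exists ([set n | (N <= n)%N], [set n | (N <= n)%N]) => /=.
    by split; exists N.
  move=> [m n] /= [Nm Nn]; rewrite -ball_normE /= rnormE ltcR.
  exact: uN.
by move=> /cvg_ex[x ux]; exists x; apply/tends_cvg.
Qed.

(** Real and imaginary parts are dominated by [rnorm], so both form Cauchy sequences in [R] and
    completeness of [R] applies to each. *)
Lemma rcauchy_scalar (u : nat -> R[i]) :
  (forall eps : R, 0 < eps -> exists N, forall m n, (N <= m)%N -> (N <= n)%N ->
     rnorm (u m - u n) < eps) ->
  exists x, tends u x.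
Proof.
move=> cu.
have part (p : R[i] -> R) : (forall a, `|p a| <= rnorm a) ->
    (forall a b, p (a - b) = p a - p b) ->
    exists t : R, forall eps, 0 < eps -> exists N, forall n, (N <= n)%N ->
      `|p (u n) - t| < eps.
  move=> ple pB.
  have /cauchy_cvgP/cvg_ex[t /cvgrPdist_lt ut] : cauchy ((p \o u) @ \oo).
    apply/cauchy_ballP => eps /cu[N uN].
    rewrite near_map2; exists ([set n | (N <= n)%N], [set n | (N <= n)%N]) => /=.
      by split; exists N.
    move=> [m n] /= [Nm Nn]; rewrite /ball /= -pB.
    exact: le_lt_trans (ple _) (uN _ _ Nm Nn).
  exists t => eps /ut[N _ uN]; exists N => n Nn.
  by rewrite distrC; exact: uN.
have [a ua] := part _ Re_le_rnorm (fun _ _ => raddfB _ _ _).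
have [b ub] := part _ Im_le_rnorm (fun _ _ => raddfB _ _ _).
exists (a +i* b)%C => eps eps0.
have e2 : 0 < eps / 2 by rewrite divr_gt0.
have [N1 uN1] := ua _ e2; have [N2 uN2] := ub _ e2.
exists (maxn N1 N2) => n; rewrite geq_max => /andP[n1 n2].
apply: le_lt_trans (rnorm_complex _) _.
by rewrite !raddfB /= [ltRHS]splitr ltrD ?uN1 ?uN2.
Qed.

Section Limits.
Variable V : normedModType R[i].
Implicit Types (u v : nat -> V) (x y : V).

Lemma tends_unique u x y : tends u x -> tends u y -> x = y.
Proof.
by move=> /tends_cvg ux /tends_cvg uy; exact: cvg_unique ux uy.
Qed.

Lemma tendsD u v x y : tends u x -> tends v y -> tends (fun n => u n + v n) (x + y).
Proof.
by move=> /tends_cvg ux /tends_cvg uy; apply/tends_cvg; exact: cvgD.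
Qed.

Lemma tendsZ u x (a : R[i]) : tends u x -> tends (fun n => a *: u n) (a *: x).
Proof. by move=> /tends_cvg ux; apply/tends_cvg; exact: cvgZr. Qed.

Lemma tends_le u x (M : R) : tends u x -> (forall n, rnorm (u n) <= M) ->
  rnorm x <= M.
Proof.
move=> ux uM; apply/ler_addgt0Pr => eps /ux[N /(_ N (leqnn N))]; rewrite rdistC => uN.
have := ler_rnormD (x - u N) (u N); rewrite subrK => /le_trans; apply.
by rewrite addrC lerD// ltW.
Qed.

Lemma tends_bounded u x : tends u x -> exists M : R, forall n, rnorm (u n) <= M.
Proof.
move=> /(_ 1 ltr01)[N uN].
exists (rnorm x + 1 + \sum_(i < N) rnorm (u i)) => n.
have sum0 : 0 <= \sum_(i < N) rnorm (u i) by apply: sumr_ge0 => i _; exact: rnorm_ge0.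
have [Nn|nN] := leqP N n.
  have := ler_rnormD (u n - x) x; rewrite subrK => /le_trans; apply.
  have := uN _ Nn; lra.
rewrite (bigD1 (Ordinal nN)) //=.
have : 0 <= \sum_(i < N | i != Ordinal nN) rnorm (u i).
  by apply: sumr_ge0 => i _; exact: rnorm_ge0.
have := rnorm_ge0 x; lra.
Qed.

Lemma tends_rcauchy u x : tends u x -> forall eps : R, 0 < eps ->
  exists N, forall m n, (N <= m)%N -> (N <= n)%N -> rnorm (u m - u n) < eps.
Proof.
move=> ux eps eps0; have [|N uN] := ux (eps / 2); first by rewrite divr_gt0.
exists N => m n Nm Nn; apply: le_lt_trans (ler_rdistD x _ _) _.
by rewrite [rnorm (x - _)]rdistC [ltRHS]splitr ltrD ?uN.
Qed.

End Limits.

Lemma half_pow_lt (eps : R) : 0 < eps -> exists n, 2^-1 ^+ n < eps.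
Proof.
move=> eps0.
have := @cvg_geometric R 1 2^-1; rewrite ger0_norm ?invr_ge0// invf_lt1// ltr1n.
move=> /(_ isT)/cvgrPdist_lt/(_ _ eps0)[N _ /(_ N (leqnn N))] /=.
rewrite /geometric /= mul1r sub0r normrN ger0_norm ?exprn_ge0 ?invr_ge0//.
by exists N.
Qed.

Lemma sum_half_pow (m n : nat) : (m <= n)%N ->
  \sum_(m <= i < n) 2^-1 ^+ i <= 2 * 2^-1 ^+ m :> R.
Proof.
move=> mn; suff : \sum_(m <= i < n) 2^-1 ^+ i = 2 * 2^-1 ^+ m - 2 * 2^-1 ^+ n :> R.
  move=> ->; rewrite gerBl mulr_ge0// exprn_ge0// invr_ge0//.
elim: n mn => [|n IH]; first by rewrite leqn0 => /eqP ->; rewrite big_geq// subrr.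
rewrite leq_eqVlt => /predU1P[->|]; first by rewrite big_geq// subrr.
rewrite ltnS => mn; rewrite big_nat_recr//= IH// [_ ^+ n.+1]exprS mulrA divff// mul1r.
by lra.
Qed.

(** * Baire category by nested balls *)

Section BaireCategory.
Variables (V : completeNormedModType R[i]) (A : nat -> set V).
Hypothesis A_cover : forall x, exists j, A j x.

(** If no [A j] were dense in a ball, every ball would contain a smaller one that misses [A j]. The
    centres of such nested balls converge to a point in no [A j]. *)
Lemma baire_cover : exists j x (rho : R), 0 < rho /\
  forall y, rnorm (y - x) < rho -> forall eta : R, 0 < eta ->
    exists2 a, A j a & rnorm (y - a) < eta.
Proof.
apply: contrapT => nobaire.
(* Positivity of the old radius is a premise under the existential, so that [choice] gives a total
   function; [(0, 0)] is a dummy value. *)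
have step (jb : nat * (V * R)) : exists b : V * R, 0 < jb.2.2 ->
    [/\ 0 < b.2, b.2 <= 2^-1 ^+ jb.1,
        forall z, rnorm (z - b.1) <= b.2 -> rnorm (z - jb.2.1) <= jb.2.2
      & forall z, rnorm (z - b.1) <= b.2 -> ~ A jb.1 z].
  case: jb => j [x rho] /=; have [rho0|] := ltP 0 rho; last by exists (0, 0).
  have : ~ forall y, rnorm (y - x) < rho -> forall eta : R, 0 < eta ->
    exists2 a, A j a & rnorm (y - a) < eta.
    by move=> h; apply: nobaire; exists j, x, rho.
  move=> /existsNP[y] /not_implyP[yx] /existsNP[eta] /not_implyP[eta0 noa].
  (* The three bounds make the closed ball miss [A j], nest it in the previous ball, and make the
     centres Cauchy. *)
  pose t := Num.min (Num.min (eta / 2) (rho - rnorm (y - x))) (2^-1 ^+ j).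
  have t_eta : t <= eta / 2 by rewrite /t !ge_min lexx.
  have t_rho : t <= rho - rnorm (y - x) by rewrite /t !ge_min lexx !orbT.
  have t_j : t <= 2^-1 ^+ j by rewrite /t ge_min lexx !orbT.
  exists (y, t) => _ /=; split => //.
  - by rewrite /t !lt_min divr_gt0// subr_gt0 yx exprn_gt0// invr_gt0.
  - move=> z zy; apply: le_trans (ler_rdistD y _ _) _; lra.
  - move=> z zy Az; apply: noa; exists z => //; rewrite rdistC; lra.
have [F FP] := choice step.
pose b := fix b n := if n is n'.+1 then F (n', b n') else (0, 1).
have b_gt0 n : 0 < (b n).2.
  by elim: n => [|n IH] //=; have [] := FP (n, b n) IH.
have b_sub n k z : rnorm (z - (b (n + k)%N).1) <= (b (n + k)%N).2 ->
    rnorm (z - (b n).1) <= (b n).2.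
  elim: k => [|k IH]; first by rewrite addn0.
  rewrite addnS => zb; apply: IH.
  by have [_ _ sub _] := FP ((n + k)%N, b (n + k)%N) (b_gt0 _); exact: sub _ zb.
have b_small n : (b n.+1).2 <= 2^-1 ^+ n.
  by have [] := FP (n, b n) (b_gt0 _).
have b_in n m : (n <= m)%N -> rnorm ((b m).1 - (b n).1) <= (b n).2.
  move=> nm; have := b_sub n (m - n)%N (b m).1.
  by rewrite subnKC// subrr rnorm0; apply; exact: ltW.
have [z bz] : exists z, tends (fun n => (b n).1) z.
  apply: rcauchy_tends => eps eps0.
  have [N hN] : exists N, 2^-1 ^+ N < eps / 2 by apply: half_pow_lt; rewrite divr_gt0.
  exists N.+1 => m n mN nN; apply: le_lt_trans (ler_rdistD (b N.+1).1 _ _) _.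
  rewrite [rnorm (_ - (b n).1)]rdistC [ltRHS]splitr ltrD//.
    exact: le_lt_trans (b_in _ _ mN) (le_lt_trans (b_small _) hN).
  exact: le_lt_trans (b_in _ _ nN) (le_lt_trans (b_small _) hN).
have z_in n : rnorm (z - (b n).1) <= (b n).2.
  apply/ler_addgt0Pr => eps /bz[N bN].
  apply: le_trans (ler_rdistD (b (maxn N n)).1 _ _) _.
  rewrite addrC lerD ?b_in ?leq_maxr// ltW// rdistC.
  by apply: bN; exact: leq_maxl.
have [j Aj] := A_cover z.
have [_ _ _ notA] := FP (j, b j) (b_gt0 _).
exact: notA _ (z_in j.+1) Aj.
Qed.

End BaireCategory.
End Convergence.

(** * The basis constant *)

Section Coordinates.
Context {R : realType}.
Variables (E : completeNormedModType R[i]) (e : nat -> E).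
Hypothesis basis_e : schauder_basis e.

Definition partial_sum (n : nat) (x : E) : E :=
  \sum_(i < n) coord e i x *: e i.

Lemma expansion_tends (x : E) (alpha : nat -> R[i]) :
  expansion e x alpha <-> tends (fun n => \sum_(i < n) alpha i *: e i) x.
Proof.
rewrite /expansion tends_cvg.
suff -> : series (fun n => alpha n *: e n) =
  (fun n => \sum_(i < n) alpha i *: e i) by [].
by apply/funext => n; rewrite /series /= big_mkord.
Qed.

Lemma partial_sum_tends (x : E) : tends (fun n => partial_sum n x) x.
Proof.
apply/expansion_tends; rewrite /coord.
have [alpha [hx _]] := basis_e x.
by have : [set alpha | expansion e x alpha] alpha by []; apply: xgetI.
Qed.

(** Since [coord] is picked by [xget], its values are computed by exhibiting an expansion and using
    uniqueness. *)
Lemma coord_unique (x : E) (alpha : nat -> R[i]) :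
  tends (fun n => \sum_(i < n) alpha i *: e i) x ->
  forall m, coord e m x = alpha m.
Proof.
move=> /expansion_tends hx m.
have [beta [_ uniq_beta]] := basis_e x.
rewrite -(uniq_beta _ hx); congr (_ m); apply/esym/uniq_beta.
by apply/expansion_tends; exact: partial_sum_tends.
Qed.

Lemma coordD m (x y : E) : coord e m (x + y) = coord e m x + coord e m y.
Proof.
apply: (coord_unique (alpha := fun m => coord e m x + coord e m y)).
apply: eq_tends (tendsD (partial_sum_tends x) (partial_sum_tends y)) => n.
by rewrite /partial_sum -big_split; apply: eq_bigr => i _; rewrite scalerDl.
Qed.

Lemma coordZ m (a : R[i]) (x : E) : coord e m (a *: x) = a * coord e m x.
Proof.
apply: (coord_unique (alpha := fun m => a * coord e m x)).
apply: eq_tends (tendsZ a (partial_sum_tends x)) => n.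
by rewrite scaler_sumr; apply: eq_bigr => i _; rewrite scalerA.
Qed.

Lemma coord0 m : coord e m 0 = 0.
Proof. by rewrite -[0](scale0r 0) coordZ mul0r. Qed.

Lemma coordN m (x : E) : coord e m (- x) = - coord e m x.
Proof. by rewrite -scaleN1r coordZ mulN1r. Qed.

Lemma coordB m (x y : E) : coord e m (x - y) = coord e m x - coord e m y.
Proof. by rewrite coordD coordN. Qed.

Lemma coord_big m (I : Type) (r : seq I) (P : pred I) (x : I -> E) :
  coord e m (\sum_(i <- r | P i) x i) = \sum_(i <- r | P i) coord e m (x i).
Proof.
by elim/big_ind2 : _ => // [|x1 y1 x2 y2 <- <-]; rewrite ?coord0 ?coordD.
Qed.

Lemma coord_e m n : coord e m (e n) = (m == n)%:R.
Proof.
apply: (coord_unique (alpha := fun m => (m == n)%:R)) => eps eps0.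
exists n.+1 => k nk; rewrite (bigD1 (Ordinal nk)) //= eqxx scale1r big1 => [|i].
  by rewrite addr0 subrr rnorm0.
by rewrite -val_eqE /= => /negbTE ->; rewrite scale0r.
Qed.

Lemma coord_sum m n (alpha : nat -> R[i]) :
  coord e m (\sum_(i < n) alpha i *: e i) = if (m < n)%N then alpha m else 0.
Proof.
rewrite coord_big; under eq_bigr do rewrite coordZ coord_e.
case: ifP => [mn|/negbT]; last rewrite -leqNgt => nm.
  rewrite (bigD1 (Ordinal mn)) //= eqxx mulr1 big1 ?addr0// => i.
  by rewrite -val_eqE /= eq_sym => /negbTE ->; rewrite mulr0.
rewrite big1// => i _; rewrite gtn_eqF ?mulr0//.
exact: leq_trans (ltn_ord i) nm.
Qed.

Lemma coord_ext (x y : E) : (forall m, coord e m x = coord e m y) -> x = y.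
Proof.
move=> xy; apply: tends_unique (partial_sum_tends x) _.
apply: eq_tends (partial_sum_tends y) => n.
by apply: eq_bigr => i _; rewrite xy.
Qed.

Lemma basis_neq0 n : e n != 0.
Proof.
apply/eqP => en0; have := coord_e n n; rewrite en0 coord0 eqxx.
by move=> /esym/eqP; rewrite oner_eq0.
Qed.

Lemma basis_gt0 n : 0 < rnorm (e n).
Proof. exact/rnorm_gt0/basis_neq0. Qed.

Lemma partial_sumD n (x y : E) :
  partial_sum n (x + y) = partial_sum n x + partial_sum n y.
Proof.
by rewrite /partial_sum -big_split; apply: eq_bigr => i _; rewrite coordD scalerDl.
Qed.

Lemma partial_sumZ n (a : R[i]) (x : E) :
  partial_sum n (a *: x) = a *: partial_sum n x.
Proof.
by rewrite /partial_sum scaler_sumr; apply: eq_bigr => i _; rewrite coordZ scalerA.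
Qed.

Lemma partial_sum0 n : partial_sum n 0 = 0.
Proof. by rewrite /partial_sum big1 // => i _; rewrite coord0 scale0r. Qed.

Lemma partial_sumN n (x : E) : partial_sum n (- x) = - partial_sum n x.
Proof. by rewrite -scaleN1r partial_sumZ scaleN1r. Qed.

Lemma partial_sum_big n (I : Type) (r : seq I) (P : pred I) (x : I -> E) :
  partial_sum n (\sum_(i <- r | P i) x i) =
  \sum_(i <- r | P i) partial_sum n (x i).
Proof.
by elim/big_ind2 : _ => // [|x1 y1 x2 y2 <- <-]; rewrite ?partial_sum0 ?partial_sumD.
Qed.

Lemma partial_sum_basis n k :
  partial_sum n (e k) = if (k < n)%N then e k else 0.
Proof.
rewrite /partial_sum; under eq_bigr do rewrite coord_e.
case: ifP => [kn|/negbT]; last rewrite -leqNgt => nk.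
  rewrite (bigD1 (Ordinal kn)) //= eqxx scale1r big1 ?addr0// => i.
  by rewrite -val_eqE /= => /negbTE ->; rewrite scale0r.
rewrite big1// => i _; rewrite ltn_eqF ?scale0r//.
exact: leq_trans (ltn_ord i) nk.
Qed.

(* A Baire category argument, combined with successive approximation: the sets
   on which all partial sums are bounded by [j] cover the space. *)
Lemma basis_almost_bounded : exists2 D : R, 0 < D &
  forall (x : E) (eta : R), 0 < eta -> exists2 a : E, rnorm (x - a) < eta &
    forall n, rnorm (partial_sum n a) <= D * rnorm x.
Proof.
pose A (j : nat) : set E := [set x | forall n, rnorm (partial_sum n x) <= j%:R].
have [|j [x0 [rho [rho0 dense_j]]]] := @baire_cover R E A.
  move=> x; have [M hM] := tends_bounded (partial_sum_tends x).
  exists (Num.bound M) => n; apply: le_trans (hM n) _.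
  have := archi_boundP (le_trans (rnorm_ge0 _) (hM 0%N)).
  exact: ltW.
exists (4 * (j%:R + 1) / rho).
  by rewrite divr_gt0// mulr_gt0// ltr_wpDl.
move=> x eta eta0; have [->|xN0] := eqVneq x 0.
  by exists 0 => [|n]; rewrite ?partial_sum0 ?subr0 rnorm0 ?mulr0.
have x_gt0 := rnorm_gt0 xN0.
(* Scaling by [t] gives [y] norm [rho / 2], so [x0 + y] and [x0] both lie in the ball where [A j] is
   dense; the difference of their approximants approximates [y]. *)
pose t := rho / (2 * rnorm x).
have t0 : 0 < t by rewrite divr_gt0// mulr_gt0.
pose y := (t%:C%C : R[i]) *: x.
have rt : rnorm (t%:C%C : R[i]) = t by rewrite rnorm_real gtr0_norm.
have tC0 : (t%:C%C : R[i]) != 0 by apply: contraTneq t0 => -[->]; rewrite ltxx.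
have ry : rnorm y < rho.
  rewrite /y rnormZ rt /t invfM mulrA -mulrA mulVf ?gt_eqF// mulr1; lra.
have e2 : 0 < t * eta / 2 by rewrite divr_gt0// mulr_gt0.
have [|a1 A1 ya1] := dense_j (x0 + y) _ _ e2; first by rewrite addrC addKr.
have [|a2 A2 xa2] := dense_j x0 _ _ e2; first by rewrite subrr rnorm0.
exists ((t%:C%C : R[i])^-1 *: (a1 - a2)) => [|n].
  have -> : x - (t%:C%C : R[i])^-1 *: (a1 - a2) =
      (t%:C%C : R[i])^-1 *: ((x0 + y - a1) - (x0 - a2)).
    rewrite -[x in LHS](scalerK tC0) -/y -scalerBr; congr (_ *: _).
    rewrite !opprB [a2 - x0]addrC addrACA [x0 + y]addrC addrK.
    by rewrite [a2 - a1]addrC.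
  rewrite rnormZ rnormV rt mulrC ltr_pdivrMr//.
  by apply: le_lt_trans (ler_rnormB _ _) _; lra.
rewrite partial_sumZ partial_sumD partial_sumN rnormZ rnormV rt.
rewrite mulrC ler_pdivrMr//.
have -> : 4 * (j%:R + 1) / rho * rnorm x * t = 2 * (j%:R + 1).
  rewrite /t; field; rewrite !gt_eqF//.
by apply: le_trans (ler_rnormB _ _) _; have := A1 n; have := A2 n; lra.
Qed.

(** The vector [x] is a series of approximants whose partial sums decay geometrically, with total at
    most [2 * D * rnorm x]. Continuity of the coordinates is not yet available: the coordinatewise
    sums of the series are shown to expand [x], and uniqueness identifies them with its
    coordinates. *)
Theorem basis_constant : exists2 K : R, 0 < K &
  forall n x, rnorm (partial_sum n x) <= K * rnorm x.
Proof.
have [D D0 approx] := basis_almost_bounded.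
exists (2 * D) => [|n x]; first by rewrite mulr_gt0.
have [->|xN0] := eqVneq x 0; first by rewrite partial_sum0 rnorm0 mulr0.
have rx0 := rnorm_gt0 xN0; set h := 2^-1 : R.
have h0 k : 0 < h ^+ k by rewrite exprn_gt0// invr_gt0.
have /choice[a aP] (kz : nat * E) : exists a : E,
    rnorm (kz.2 - a) < rnorm x * h ^+ kz.1.+1 /\
    forall m, rnorm (partial_sum m a) <= D * rnorm kz.2.
  have [|b b1 b2] := approx kz.2 (rnorm x * h ^+ kz.1.+1); last by exists b.
  exact: mulr_gt0.
(* [r k] is the remainder after [k] approximations, and [y k] below is the sum of the first [k]
   approximants. *)
pose r := fix r k := if k is k'.+1 then r k' - a (k', r k') else x.
have r_small k : rnorm (r k) <= rnorm x * h ^+ k.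
  case: k => [|k]; first by rewrite /= expr0 mulr1.
  by have [/ltW] := aP (k, r k).
have a_small k m : rnorm (partial_sum m (a (k, r k))) <= D * rnorm x * h ^+ k.
  have [_ /(_ m) /le_trans] := aP (k, r k); apply.
  by rewrite -mulrA ler_pM2l// r_small.
pose y k := x - r k.
have yS k : y k.+1 = y k + a (k, r k) by rewrite /y /= opprB addrA addrAC.
have y_diff m k l : (k <= l)%N ->
    rnorm (partial_sum m (y l) - partial_sum m (y k)) <= 2 * D * rnorm x * h ^+ k.
  move=> kl; apply: (@le_trans _ _ (\sum_(k <= i < l) D * rnorm x * h ^+ i)).
    elim: l kl => [|l IH].
      by rewrite leqn0 => /eqP ->; rewrite big_geq// subrr rnorm0.
    rewrite leq_eqVlt => /predU1P[->|]; first by rewrite big_geq// subrr rnorm0.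
    rewrite ltnS => kl; rewrite big_nat_recr//= yS partial_sumD addrAC.
    by apply: le_trans (ler_rnormD _ _) _; rewrite lerD ?IH.
  rewrite -mulr_sumr; have := @sum_half_pow R _ _ kl.
  have : 0 < D * rnorm x by rewrite mulr_gt0.
  move=> p0 hs; have := ler_wpM2l (ltW p0) hs; rewrite -/h; lra.
have hsmall c eps : 0 < c -> 0 < eps -> exists k, c * h ^+ k < eps.
  move=> c0 eps0; have [k hk] := half_pow_lt (divr_gt0 eps0 c0).
  by exists k; rewrite mulrC -ltr_pdivlMr.
have c0 : 0 < 2 * D * rnorm x by rewrite !mulr_gt0.
(* A coordinate times [e m] is a difference of two partial sums, so [y_diff] makes the coordinates
   of [y k] Cauchy. *)
have /choice[beta betaP] m : exists b, tends (fun k => coord e m (y k)) b.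
  apply: rcauchy_scalar => eps eps0.
  have [||k hk] := hsmall (4 * (2 * D * rnorm x)) (eps * rnorm (e m)).
    by rewrite mulr_gt0.
    by rewrite mulr_gt0 ?basis_gt0.
  have main l : (k <= l)%N ->
      rnorm (coord e m (y l) - coord e m (y k)) * rnorm (e m) <=
      2 * (2 * D * rnorm x * h ^+ k).
    move=> kl; rewrite -rnormZ scalerBl.
    have sumE z : coord e m z *: e m = partial_sum m.+1 z - partial_sum m z.
      by rewrite /partial_sum big_ord_recr /= [in RHS]addrC addrK.
    rewrite !sumE opprB addrACA [- _ - _]addrC addrACA.
    have := y_diff m.+1 _ _ kl; have := y_diff m _ _ kl; rewrite rdistC => h1 h2.
    have := ler_rnormD (partial_sum m.+1 (y l) - partial_sum m.+1 (y k))
      (partial_sum m (y k) - partial_sum m (y l)).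
    lra.
  exists k => l l' kl kl'.
  rewrite -(ltr_pM2r (basis_gt0 m)).
  apply: le_lt_trans (_ : _ <= (rnorm (coord e m (y l) - coord e m (y k)) +
    rnorm (coord e m (y k) - coord e m (y l'))) * rnorm (e m)) _.
    by rewrite ler_pM2r ?basis_gt0// ler_rdistD.
  rewrite mulrDl [X in _ + X * _]rdistC.
  by have := main _ kl; have := main _ kl'; lra.
pose T m := \sum_(i < m) beta i *: e i.
have T_lim m : tends (fun k => partial_sum m (y k)) (T m).
  elim: m => [|m IH].
    apply: (@eq_tends _ _ (fun _ => 0)) => [k|eps eps0].
      by rewrite /partial_sum big_ord0.
    by exists 0%N => k _; rewrite /T big_ord0 subrr rnorm0.
  rewrite /T big_ord_recr /=.
  apply: (@eq_tends _ _ (fun k => partial_sum m (y k) + coord e m (y k) *: e m)).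
    by move=> k; rewrite /partial_sum big_ord_recr.
  apply: tendsD IH _ => eps eps0.
  have [|N hN] := betaP m (eps / rnorm (e m)); first by rewrite divr_gt0 ?basis_gt0.
  exists N => k Nk; rewrite -scalerBl rnormZ -ltr_pdivlMr ?basis_gt0//.
  exact: hN.
(* This bound is uniform in [m], which permits exchanging the limits in [k] and [m] in [T_x]. *)
have T_diff m k : rnorm (T m - partial_sum m (y k)) <= 2 * D * rnorm x * h ^+ k.
  apply/ler_addgt0Pr => eps /(T_lim m)[N hN].
  apply: le_trans (ler_rdistD (partial_sum m (y (maxn N k))) _ _) _.
  rewrite addrC lerD ?y_diff ?leq_maxr// ltW// rdistC.
  by apply: hN; exact: leq_maxl.
have T_x : tends T x.
  move=> eps eps0.
  have e3 : 0 < eps / 3 by rewrite divr_gt0.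
  have [k1 hk1] := hsmall _ _ c0 e3.
  have [k2 hk2] := hsmall _ _ rx0 e3.
  pose k := maxn k1 k2.
  have hmon i j : (i <= j)%N -> h ^+ j <= h ^+ i.
    by move=> ij; rewrite ler_wiXn2l// ?invr_ge0// invf_le1// ler1n.
  have [N hN] := partial_sum_tends (y k) e3.
  exists N => m Nm.
  have := ler_rdistD (partial_sum m (y k)) (T m) x.
  have := ler_rdistD (y k) (partial_sum m (y k)) x.
  have := hN _ Nm; have := T_diff m k; have := r_small k.
  have -> : y k - x = - r k by rewrite /y addrAC subrr add0r.
  rewrite rnormN.
  have : 2 * D * rnorm x * h ^+ k <= 2 * D * rnorm x * h ^+ k1.
    by apply: ler_wpM2l; [exact: ltW|apply: hmon; exact: leq_maxl].
  have : rnorm x * h ^+ k <= rnorm x * h ^+ k2.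
    by apply: ler_wpM2l; [exact: ltW|apply: hmon; exact: leq_maxr].
  lra.
(* By [T_x] and uniqueness [beta] gives the coordinates of [x]; the bound is then [T_diff] at
   [k = 0], where [y 0 = 0]. *)
have -> : partial_sum n x = T n.
  by apply: eq_bigr => i _; rewrite (coord_unique T_x).
by have := T_diff n 0%N; rewrite /y /= subrr partial_sum0 subr0 expr0 mulr1.
Qed.

End Coordinates.

(** * Bounded operators *)

Section BoundedOperators.
Context {R : realType}.

Section Basics.
Variables (E F : normedModType R[i]) (a : E -> F).
Hypothesis bounded_a : bounded_operator a.

Lemma bopD x y : a (x + y) = a x + a y.
Proof. by have [lin _] := bounded_a; have := lin 1 x y; rewrite !scale1r. Qed.

Lemma bop0 : a 0 = 0.
Proof. by apply: (addrI (a 0)); rewrite -bopD !addr0. Qed.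

Lemma bopZ k x : a (k *: x) = k *: a x.
Proof. by have [lin _] := bounded_a; have := lin k x 0; rewrite !addr0 bop0 addr0. Qed.

Lemma bopB x y : a (x - y) = a x - a y.
Proof. by rewrite bopD -scaleN1r bopZ scaleN1r. Qed.

Lemma bop_big (I : Type) (r : seq I) (P : pred I) (x : I -> E) :
  a (\sum_(i <- r | P i) x i) = \sum_(i <- r | P i) a (x i).
Proof.
by elim/big_ind2 : _ => // [|x1 y1 x2 y2 <- <-]; rewrite ?bop0 ?bopD.
Qed.

Lemma bop_bound : exists2 M : R, 0 < M & forall x, rnorm (a x) <= M * rnorm x.
Proof.
have [_ [M hM]] := bounded_a; exists (Num.max M 1) => [|x].
  by rewrite lt_max ltr01 orbT.
by apply: le_trans (hM x) _; rewrite ler_wpM2r ?rnorm_ge0// le_max lexx.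
Qed.

Lemma opnorm_has_sup : has_sup [set rnorm (a x) | x in [set x : E | rnorm x <= 1]].
Proof.
split; first by exists (rnorm (a 0)), 0 => //=; rewrite rnorm0.
have [M M0 hM] := bop_bound; exists M => _ [x /= x1 <-].
by apply: le_trans (hM x) _; rewrite ler_piMr// ltW.
Qed.

Lemma opnorm_ge0 : 0 <= opnorm a.
Proof.
apply: (@le_trans _ _ (rnorm (a 0))); first exact: rnorm_ge0.
apply: sup_upper_bound; first exact: opnorm_has_sup.
by exists 0 => //=; rewrite rnorm0.
Qed.

Lemma opnormP x : rnorm (a x) <= opnorm a * rnorm x.
Proof.
have [->|x0] := eqVneq x 0; first by rewrite bop0 !rnorm0 mulr0.
have rx := rnorm_gt0 x0; rewrite -ler_pdivrMr//.
have rt : rnorm ((rnorm x)^-1%:C%C : R[i]) = (rnorm x)^-1.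
  by rewrite rnorm_real gtr0_norm ?invr_gt0.
apply: sup_upper_bound; first exact: opnorm_has_sup.
exists ((rnorm x)^-1%:C%C *: x) => /=; first by rewrite rnormZ rt mulVf ?gt_eqF.
by rewrite bopZ rnormZ rt mulrC.
Qed.

Lemma opnorm_le M : 0 <= M -> (forall x, rnorm (a x) <= M * rnorm x) ->
  opnorm a <= M.
Proof.
move=> M0 hM; apply: ge_sup; first by have [] := opnorm_has_sup.
move=> _ [x /= x1 <-]; apply: le_trans (hM x) _.
by rewrite ler_piMr.
Qed.

Lemma bop_tends (u : nat -> E) x : tends u x -> tends (a \o u) (a x).
Proof.
move=> ux eps eps0; have [M M0 hM] := bop_bound.
have [|N hN] := ux (eps / M); first by rewrite divr_gt0.
exists N => n Nn /=; rewrite -bopB; apply: le_lt_trans (hM _) _.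
by rewrite mulrC -ltr_pdivlMr// hN.
Qed.

End Basics.

Section Constructions.
Variables E F G : normedModType R[i].

Lemma bop_comp (a : F -> G) (b : E -> F) :
  bounded_operator a -> bounded_operator b -> bounded_operator (a \o b).
Proof.
move=> ba bb; split => [k x y /=|]; first by rewrite (bopD bb) (bopZ bb) (bopD ba) (bopZ ba).
have [M M0 hM] := bop_bound ba; have [L L0 hL] := bop_bound bb.
exists (M * L) => x /=; apply: le_trans (hM _) _.
by rewrite -mulrA ler_pM2l.
Qed.

Lemma bop_add (a b : E -> F) :
  bounded_operator a -> bounded_operator b -> bounded_operator (a \+ b).
Proof.
move=> ba bb; split => [k x y /=|].
  by rewrite (bopD bb) (bopZ bb) (bopD ba) (bopZ ba) scalerDr addrACA.
have [M M0 hM] := bop_bound ba; have [L L0 hL] := bop_bound bb.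
exists (M + L) => x /=; apply: le_trans (ler_rnormD _ _) _.
by rewrite mulrDl lerD.
Qed.

Lemma bop_scale (k : R[i]) (a : E -> F) :
  bounded_operator a -> bounded_operator (k \*: a).
Proof.
move=> ba; split => [l x y /=|].
  by rewrite (bopD ba) (bopZ ba) scalerDr !scalerA mulrC.
have [M M0 hM] := bop_bound ba.
exists (rnorm k * M) => x /=; rewrite rnormZ -mulrA ler_wpM2l ?rnorm_ge0//.
Qed.

Lemma bop_sub (a b : E -> F) :
  bounded_operator a -> bounded_operator b -> bounded_operator (a \- b).
Proof.
move=> ba bb; rewrite (_ : a \- b = a \+ (-1 \*: b)).
  by apply: bop_add => //; exact: bop_scale.
by apply/funext => x /=; rewrite scaleN1r.
Qed.

End Constructions.

End BoundedOperators.

(** * Coordinate functionals and operators defined on a basis *)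

Section BasisOperators.
Context {R : realType}.
Variables (E : completeNormedModType R[i]) (e : nat -> E).
Hypothesis basis_e : schauder_basis e.

(** [coord e m x *: e m] is a difference of consecutive partial sums. The factor [rnorm (e m)]
    remains because a general basis need not be seminormalized. *)
Lemma coord_bound : exists2 K : R, 0 < K &
  forall m x, rnorm (coord e m x) * rnorm (e m) <= K * rnorm x.
Proof.
have [K K0 hK] := basis_constant basis_e; exists (K + K) => [|m x].
  exact: addr_gt0.
rewrite -rnormZ.
have -> : coord e m x *: e m = partial_sum e m.+1 x - partial_sum e m x.
  by rewrite /partial_sum big_ord_recr /= [in RHS]addrC addrK.
by apply: le_trans (ler_rnormB _ _) _; rewrite mulrDl lerD.
Qed.

Lemma bop_ext (F : normedModType R[i]) (a b : E -> F) :
  bounded_operator a -> bounded_operator b ->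
  (forall n, a (e n) = b (e n)) -> a = b.
Proof.
move=> ba bb ab; apply/funext => x.
apply: tends_unique (bop_tends ba (partial_sum_tends basis_e x)) _.
apply: eq_tends (bop_tends bb (partial_sum_tends basis_e x)) => n /=.
rewrite /partial_sum (bop_big ba) (bop_big bb); apply: eq_bigr => i _.
by rewrite (bopZ ba) (bopZ bb) ab.
Qed.

(** The estimate on finite sums makes the images of the partial sums Cauchy, so the operator exists
    as a pointwise limit; the basis constant bounds it. *)
Lemma basis_operator (F : completeNormedModType R[i]) (g : nat -> F) (C : R) :
  0 < C ->
  (forall n (alpha : nat -> R[i]), rnorm (\sum_(i < n) alpha i *: g i) <=
     C * rnorm (\sum_(i < n) alpha i *: e i)) ->
  exists2 a : E -> F, bounded_operator a & forall n, a (e n) = g n.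
Proof.
move=> C0 hC.
have tail (V : normedModType R[i]) (v : nat -> V) (alpha : nat -> R[i]) m n : (m <= n)%N ->
    \sum_(i < n) alpha i *: v i - \sum_(i < m) alpha i *: v i =
    \sum_(i < n) (if (i < m)%N then 0 else alpha i) *: v i.
  move=> mn; apply/eqP; rewrite subr_eq; apply/eqP.
  rewrite (big_ord_widen n (fun i => alpha i *: v i) mn).
  rewrite [X in _ + X]big_mkcond -big_split; apply: eq_bigr => i _ /=.
  by case: ifP => _; rewrite ?scale0r ?add0r ?addr0.
pose T n x := \sum_(i < n) coord e i x *: g i.
have T_diff x m n : (m <= n)%N ->
    rnorm (T n x - T m x) <= C * rnorm (partial_sum e n x - partial_sum e m x).
  move=> mn; have := hC n (fun i => if (i < m)%N then 0 else coord e i x).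
  by rewrite -!(tail _ _ (coord e ^~ x)).
have /choice[a ha] x : exists y, tends (T ^~ x) y.
  apply: rcauchy_tends => eps eps0.
  have [|N hN] := tends_rcauchy (partial_sum_tends basis_e x) (eps := eps / C).
    exact: divr_gt0.
  exists N => m n; wlog mn : m n / (n <= m)%N.
    move=> H Nm Nn; have [/H|/ltnW/H] := leqP n m; first exact.
    by rewrite rdistC; exact.
  move=> Nm Nn; apply: le_lt_trans (T_diff _ _ _ mn) _.
  by rewrite mulrC -ltr_pdivlMr// hN.
have [K K0 hK] := basis_constant basis_e.
exists a; last first.
  move=> n; apply: tends_unique (ha _) _ => eps eps0.
  exists n.+1 => k nk; suff -> : T k (e n) = g n by rewrite subrr rnorm0.
  rewrite /T (bigD1 (Ordinal nk)) //= (coord_e basis_e) eqxx scale1r.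
  rewrite [X in _ + X]big1 ?addr0// => i.
  by rewrite -val_eqE /= (coord_e basis_e) => /negbTE ->; rewrite scale0r.
split => [k x y|].
  apply: tends_unique (ha _) _.
  apply: eq_tends (tendsD (tendsZ k (ha x)) (ha y)) => n.
  rewrite /T scaler_sumr -big_split; apply: eq_bigr => i _ /=.
  by rewrite (coordD basis_e) (coordZ basis_e) scalerDl scalerA.
exists (C * K) => x; apply: tends_le (ha x) _ => n.
apply: le_trans (hC _ _) _; rewrite -mulrA ler_pM2l//; exact: hK.
Qed.

End BasisOperators.

(** * Symmetric bases *)

(** Dependent choice for gliding constructions: each block starts where the previous one ends and
    the first starts at [0], so the blocks partition [nat]. *)
Lemma blocks_choice (T : Type) (P : nat -> nat -> nat -> T -> Prop) :
  (forall k N, exists N' t, (N < N')%N /\ P k N N' t) ->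
  exists (N : nat -> nat) (t : nat -> T), N 0%N = 0%N /\
    forall k, (N k < N k.+1)%N /\ P k (N k) (N k.+1) (t k).
Proof.
move=> step.
have /choice[F FP] (kN : nat * nat) : exists N't : nat * T,
    (kN.2 < N't.1)%N /\ P kN.1 kN.2 N't.1 N't.2.
  by have [N' [t h]] := step kN.1 kN.2; exists (N', t).
pose N := fix N k := if k is k'.+1 then (F (k', N k')).1 else 0%N.
exists N, (fun k => (F (k, N k)).2); split => // k.
exact: FP (k, N k).
Qed.

Section Blocks.
Variable N : nat -> nat.
Hypotheses (N0 : N 0%N = 0%N) (N_lt : forall k, (N k < N k.+1)%N).

Lemma block_le j k : (j <= k)%N -> (N j <= N k)%N.
Proof.
elim: k => [|k IH]; first by rewrite leqn0 => /eqP ->.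
rewrite leq_eqVlt => /predU1P[->//|]; rewrite ltnS => /IH /leq_trans; apply.
exact: ltnW.
Qed.

Lemma block_ge k : (k <= N k)%N.
Proof. by elim: k => // k IH; exact: leq_ltn_trans IH (N_lt k). Qed.

Lemma block_exists n : exists k, (N k <= n < N k.+1)%N.
Proof.
elim: n => [|n [k /andP[kn nk]]]; first by exists 0%N; rewrite N0 -[X in (X < _)%N]N0 N_lt.
have [nk'|nk'] := ltnP n.+1 (N k.+1).
  by exists k; rewrite nk' andbT ltnW.
exists k.+1; rewrite nk' /=; exact: leq_ltn_trans nk (N_lt _).
Qed.

Lemma block_uniq n j k : (N j <= n < N j.+1)%N -> (N k <= n < N k.+1)%N -> j = k.
Proof.
move=> /andP[jn nj] /andP[kn nk]; case: (ltngtP j k) => // h.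
  by have := leq_trans (leq_trans nj (block_le h)) kn; rewrite ltnn.
by have := leq_trans (leq_trans nk (block_le h)) jn; rewrite ltnn.
Qed.

Definition block_perm (M M' : nat) (p q : nat -> nat) : Prop :=
  forall n, (M <= n < M')%N ->
    [/\ (M <= p n < M')%N, (M <= q n < M')%N, q (p n) = n & p (q n) = n].

(** Each block is invariant, so [idx] does not change along the glued map and the inverses glue in
    the same way. *)
Lemma glue_blocks (p q : nat -> nat -> nat) :
  (forall k, block_perm (N k) (N k.+1) (p k) (q k)) ->
  exists2 pi : nat -> nat, bijective pi &
    forall k n, (N k <= n < N k.+1)%N -> pi n = p k n.
Proof.
move=> pq; have [idx idxP] := choice block_exists.
have idxE k n : (N k <= n < N k.+1)%N -> idx n = k.
  exact: block_uniq.
exists (fun n => p (idx n) n) => [|k n /idxE -> //].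
exists (fun n => q (idx n) n) => n.
  by have [pn _ qp _] := pq _ _ (idxP n); rewrite (idxE _ _ pn).
by have [_ qn _ pq'] := pq _ _ (idxP n); rewrite (idxE _ _ qn).
Qed.

End Blocks.

Definition swap (a b n : nat) : nat := if n == a then b else if n == b then a else n.

Lemma swapl a b : swap a b a = b.
Proof. by rewrite /swap eqxx. Qed.

Lemma swapr a b : swap a b b = a.
Proof. by rewrite /swap eqxx; case: eqP. Qed.

Lemma swapK a b : involutive (swap a b).
Proof.
move=> n; rewrite {2}/swap; case: (eqVneq n a) => [->|na]; first exact: swapr.
by case: (eqVneq n b) => [->|nb]; rewrite ?swapl// /swap (negbTE na) (negbTE nb).
Qed.

Lemma swap_block_perm a b M M' : (M <= a < M')%N -> (M <= b < M')%N ->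
  block_perm M M' (swap a b) (swap a b).
Proof.
move=> aM bM n nM; rewrite swapK.
suff : (M <= swap a b n < M')%N by split.
by rewrite /swap; case: ifP => // _; case: ifP.
Qed.

(* Enumerates the elements of [G] first, so that a set becomes an initial
   segment of the block. *)
Lemma sorting_block_perm (G : pred nat) M M' : (M <= M')%N ->
  exists p q g, block_perm M M' p q /\
    forall n, (M <= n < M')%N -> (p n < g)%N = G n.
Proof.
move=> MM'; pose r := index_iota M M'.
pose s := [seq n <- r | G n] ++ [seq n <- r | predC G n].
have sr : perm_eq s r by rewrite perm_filterC.
have size_s : size s = (M' - M)%N by rewrite (perm_size sr) size_iota.
have uniq_s : uniq s by rewrite (perm_uniq sr) iota_uniq.
have mem_s n : (n \in s) = (M <= n < M')%N by rewrite (perm_mem sr) mem_index_iota.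
exists (fun n => M + index n s)%N, (fun n => nth 0%N s (n - M)), (M + size [seq n <- r | G n])%N.
split=> n nM.
  have ns : n \in s by rewrite mem_s.
  have ids : (index n s < M' - M)%N by rewrite -size_s index_mem.
  have nMs : (n - M < size s)%N by rewrite size_s; move/andP: nM => []; lia.
  split; first by move: ids; lia.
  - by rewrite -mem_s mem_nth.
  - by rewrite addKn nth_index.
  - by rewrite index_uniq// subnKC//; case/andP: nM.
rewrite ltn_add2l /s index_cat mem_filter mem_index_iota nM andbT.
case: ifP => Gn; first by rewrite index_mem mem_filter Gn mem_index_iota.
by rewrite ltnNge leq_addr.
Qed.

(** * Seminormalization and unconditionality *)

Definition cutoff (T : nmodType) (G : pred nat) (alpha : nat -> T) (n : nat) : T :=
  if G n then alpha n else 0.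

Section SymmetricBases.
Context {R : realType}.

(** [equivalent_with] speaks of nonempty sums only; the empty sum is added here and [lambda^-1] is
    cleared. *)
Lemma equivalent_sums (E F : normedModType R[i]) (lambda : R)
    (x : nat -> E) (y : nat -> F) : 1 <= lambda -> equivalent_with lambda x y ->
  forall n (alpha : nat -> R[i]),
    rnorm (\sum_(i < n) alpha i *: x i) <=
      lambda * rnorm (\sum_(i < n) alpha i *: y i) /\
    rnorm (\sum_(i < n) alpha i *: y i) <=
      lambda * rnorm (\sum_(i < n) alpha i *: x i).
Proof.
move=> l1 xy [|n] alpha; first by rewrite !big_ord0 !rnorm0 mulr0.
have /andP[h1 h2] := xy n alpha; split => //.
by rewrite -ler_pdivrMl// (lt_le_trans ltr01).
Qed.

Lemma bounded_of_tail (u : nat -> R) (N : nat) (M : R) :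
  (forall n, 0 <= u n) -> (forall n, (N <= n)%N -> u n <= M) ->
  exists2 A : R, 0 < A & forall n, u n <= A.
Proof.
move=> u0 uM; exists (1 + M + \sum_(i < N) u i) => [|n].
  have : 0 <= M by exact: le_trans (u0 _) (uM _ (leqnn _)).
  have : 0 <= \sum_(i < N) u i by apply: sumr_ge0.
  lra.
have sum0 : 0 <= \sum_(i < N) u i by apply: sumr_ge0.
have [Nn|nN] := leqP N n; first by have := uM _ Nn; lra.
rewrite (bigD1 (Ordinal nN)) //=.
have : 0 <= \sum_(i < N | i != Ordinal nN) u i by apply: sumr_ge0.
have : 0 <= M by exact: le_trans (u0 _) (uM _ (leqnn _)).
lra.
Qed.

Variables (E : completeNormedModType R[i]) (e : nat -> E).
Hypothesis sym_e : symmetric_basis e.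
Let basis_e : schauder_basis e := proj1 sym_e.

(** Makes bounds uniform: if block permutations witness failures [Q k] of every degree arbitrarily
    far out, one glued permutation carries all of them, while symmetry gives it a single constant
    [lambda]. *)
Lemma sym_blocks (Q : nat -> nat -> nat -> (nat -> nat) -> Prop) :
  (forall k N, exists N' p q, [/\ (N < N')%N, block_perm N N' p q & Q k N N' p]) ->
  exists (lambda : R) (pi : nat -> nat), [/\ 0 < lambda,
    forall n (alpha : nat -> R[i]),
      rnorm (\sum_(i < n) alpha i *: e i) <=
        lambda * rnorm (\sum_(i < n) alpha i *: e (pi i)) /\
      rnorm (\sum_(i < n) alpha i *: e (pi i)) <=
        lambda * rnorm (\sum_(i < n) alpha i *: e i)
    & forall k, exists N N' p, Q k N N' p /\
        forall n, (N <= n < N')%N -> pi n = p n].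
Proof.
move=> step.
have [|N [pq [N0 NP]]] := @blocks_choice ((nat -> nat) * (nat -> nat))
  (fun k N N' pq => block_perm N N' pq.1 pq.2 /\ Q k N N' pq.1).
  by move=> k N; have [N' [p [q [h1 h2 h3]]]] := step k N; exists N', (p, q).
have N_lt k : (N k < N k.+1)%N by have [] := NP k.
have [|pi bij_pi piE] := @glue_blocks N N0 N_lt (fun k => (pq k).1) (fun k => (pq k).2).
  by move=> k; have [_ []] := NP k.
have [lambda l1 eq_pi] := (proj2 sym_e) pi bij_pi.
exists lambda, pi; split => [||k]; first exact: lt_le_trans ltr01 l1.
  exact: equivalent_sums l1 eq_pi.
by exists (N k), (N k.+1), (pq k).1; have [_ [_ hQ]] := NP k; split => // n /piE.
Qed.

(** Otherwise each block contains a pair with norm ratio above [k], and swapping all these pairs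
    defeats any constant [lambda]. *)
Lemma sym_norm_ratio : exists (C : R) (N : nat), forall a b,
  (N <= a)%N -> (N <= b)%N -> rnorm (e a) <= C * rnorm (e b).
Proof.
apply: contrapT => noC.
pose Q k (N N' : nat) (p : nat -> nat) :=
  exists2 b, (N <= b < N')%N & k%:R * rnorm (e b) < rnorm (e (p b)).
have [|lambda [pi [l0 eq_pi blockP]]] := @sym_blocks Q.
  move=> k N; have /existsNP[a /existsNP[b /not_implyP[Na /not_implyP[Nb]]]] :
      ~ forall a b, (N <= a)%N -> (N <= b)%N -> rnorm (e a) <= k%:R * rnorm (e b).
    by move=> h; apply: noC; exists k%:R, N.
  move=> /negP; rewrite -ltNge => ab.
  exists (maxn a b).+1, (swap a b), (swap a b); split.
  - by rewrite ltnS leq_max Na.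
  - by apply: swap_block_perm; rewrite ?Na ?Nb ltnS ?leq_maxl ?leq_maxr.
  - by exists b; rewrite ?swapr// Nb ltnS leq_maxr.
have [N [N' [p [[b bN hb] piE]]]] := blockP (Num.bound lambda).
(* Kronecker coefficients reduce the equivalence to [e b] and [e (pi b)]. *)
have := proj2 (eq_pi b.+1 (fun i => (i == b)%:R)).
rewrite !big_ord_recr /= eqxx !scale1r !big1 ?add0r; last first.
- by move=> i _; rewrite ltn_eqF ?scale0r.
- by move=> i _; rewrite ltn_eqF ?scale0r.
rewrite (piE _ bN); apply/negP; rewrite -ltNge; apply: le_lt_trans hb.
by rewrite ler_wpM2r ?rnorm_ge0// ltW// archi_boundP// ltW.
Qed.

(** On a tail all norms are comparable to [rnorm (e N)]; the finitely many earlier vectors only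
    enlarge the constant. *)
Lemma sym_seminormalized : exists2 A : R, 0 < A &
  forall n, rnorm (e n) <= A /\ 1 <= A * rnorm (e n).
Proof.
have [C [N CN]] := sym_norm_ratio.
have e_gt0 := basis_gt0 basis_e.
have [|n Nn|A A0 hA] := @bounded_of_tail (fun n => rnorm (e n)) N (C * rnorm (e N)).
- by move=> n; exact: rnorm_ge0.
- exact: CN.
have [|n Nn|B B0 hB] := @bounded_of_tail (fun n => (rnorm (e n))^-1) N (C / rnorm (e N)).
- by move=> n; rewrite invr_ge0 rnorm_ge0.
- have := CN N n (leqnn N) Nn.
  rewrite -ler_pdivrMr// => h; rewrite ler_pdivlMr// mulrC//.
exists (A + B) => [|n]; first exact: addr_gt0.
split; first by have := hA n; lra.
rewrite -ler_pdivrMr// mul1r; have := hB n; lra.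
Qed.

Lemma sym_coord_bound : exists2 K : R, 0 < K &
  forall m x, rnorm (coord e m x) <= K * rnorm x.
Proof.
have [K K0 hK] := coord_bound basis_e.
have [A A0 hA] := sym_seminormalized.
exists (A * K) => [|m x]; first exact: mulr_gt0.
have [_ hm] := hA m.
apply: (@le_trans _ _ (rnorm (coord e m x) * (A * rnorm (e m)))).
  by rewrite ler_peMr ?rnorm_ge0.
by rewrite mulrCA -mulrA ler_pM2l.
Qed.

(** A permutation that lists [G] first turns the cutoff to [G] into a partial sum. A cutoff inside a
    block thus costs at most [lambda * (K * lambda)], which contradicts failures of every degree.
    Vanishing below [N] confines the coefficients to the block where the permutation is known. *)
Lemma sym_tail_unconditional : exists (C : R) (N : nat),
  0 < C /\ forall n (alpha : nat -> R[i]) (G : pred nat),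
    (forall i, (i < N)%N -> alpha i = 0) ->
    rnorm (\sum_(i < n) cutoff G alpha i *: e i) <=
      C * rnorm (\sum_(i < n) alpha i *: e i).
Proof.
apply: contrapT => noC.
pose Q k (N N' : nat) (p : nat -> nat) :=
  exists (alpha : nat -> R[i]) (G : pred nat) g,
    [/\ forall i, (i < N)%N -> alpha i = 0,
        forall n, (N <= n < N')%N -> (p n < g)%N = G n
      & k%:R * rnorm (\sum_(i < N') alpha i *: e i) <
        rnorm (\sum_(i < N') cutoff G alpha i *: e i)].
have [|lambda [pi [l0 eq_pi blockP]]] := @sym_blocks Q.
  (* The negated statement asks for a positive constant, hence [k.+1]. *)
  move=> k N; have /existsNP[n /existsNP[alpha /existsNP[G /not_implyP[alpha0]]]] :
      ~ forall n (alpha : nat -> R[i]) (G : pred nat),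
    (forall i, (i < N)%N -> alpha i = 0) ->
    rnorm (\sum_(i < n) cutoff G alpha i *: e i) <=
      k.+1%:R * rnorm (\sum_(i < n) alpha i *: e i).
    by move=> h; apply: noC; exists k.+1%:R, N.
  move=> /negP; rewrite -ltNge => hG.
  have Nn : (N < n)%N.
    rewrite ltnNge; apply/negP => nN; move: hG.
    by rewrite !big1 ?rnorm0 ?mulr0 ?ltxx// => i _; rewrite /cutoff;
       rewrite alpha0 ?if_same ?scale0r// (leq_trans (ltn_ord i)).
  have [p [q [g [pq pG]]]] := sorting_block_perm G (ltnW Nn).
  exists n, p, q; split => //; exists alpha, G, g; split => //.
  by apply: le_lt_trans hG; rewrite ler_wpM2r ?rnorm_ge0// ler_nat.
have [K K0 hK] := basis_constant basis_e.
pose M := lambda * (K * lambda).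
have [N [N' [p [[alpha [G [g [alpha0 pG hG]]]] piE]]]] := blockP (Num.bound M).
have : rnorm (\sum_(i < N') cutoff G alpha i *: e i) <=
    M * rnorm (\sum_(i < N') alpha i *: e i).
  rewrite /M -!mulrA; have [+ _] := eq_pi N' (cutoff G alpha); move=> /le_trans; apply.
  rewrite ler_pM2l//.
  (* Within the block, [pi i] is below [g] exactly when [i] is in [G]. *)
  have -> : \sum_(i < N') cutoff G alpha i *: e (pi i) =
      partial_sum e g (\sum_(i < N') alpha i *: e (pi i)).
    rewrite partial_sum_big//; apply: eq_bigr => i _.
    rewrite partial_sumZ// partial_sum_basis// /cutoff.
    have [iN|Ni] := ltnP i N; first by rewrite alpha0// if_same !scale0r.
    rewrite piE ?Ni//= pG ?Ni//=.
    by case: ifP => _; rewrite ?scale0r ?scaler0.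
  apply: le_trans (hK _ _) _; rewrite ler_pM2l//.
  by have [_] := eq_pi N' alpha.
apply/negP; rewrite -ltNge; apply: le_lt_trans hG.
rewrite ler_wpM2r ?rnorm_ge0// ltW// archi_boundP// ltW// !mulr_gt0//.
Qed.

(** The first [N] coordinates cost at most [N%:R * K] under any cutoff. The rest is the vector minus
    this head, of norm at most [1 + N%:R * K] times the original, and the tail estimate applies to
    it. *)
Lemma sym_unconditional : exists2 C : R, 0 < C &
  forall n (alpha : nat -> R[i]) (G : pred nat),
    rnorm (\sum_(i < n) cutoff G alpha i *: e i) <=
      C * rnorm (\sum_(i < n) alpha i *: e i).
Proof.
have [C [N [C0 hC]]] := sym_tail_unconditional.
have [K K0 hK] := coord_bound basis_e.
exists (N%:R * K + C * (1 + N%:R * K)) => [|n alpha G].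
  have NK : 0 <= N%:R * K by rewrite mulr_ge0// ltW.
  by apply: ltr_wpDl => //; apply: mulr_gt0 => //; exact: ltr_wpDr.
set x := \sum_(i < n) alpha i *: e i.
have low (H : pred nat) :
    rnorm (\sum_(i < n) cutoff H (cutoff (fun i => (i < N)%N) alpha) i *: e i) <=
    N%:R * K * rnorm x.
  apply: le_trans (ler_rnorm_sum _ _ _) _.
  apply: (@le_trans _ _ (\sum_(i < n) (if (i < N)%N then K * rnorm x else 0))).
    apply: ler_sum => i _; rewrite /cutoff.
    case: (H i); last first.
      by rewrite scale0r rnorm0; case: ifP => // _; rewrite mulr_ge0 ?rnorm_ge0 ?ltW.
    case: ifP => _; last by rewrite scale0r rnorm0.
    by have := hK i x; rewrite coord_sum// ltn_ord -rnormZ.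
  rewrite -mulrA -[n]subn0 -(big_mkord xpredT (fun i => if (i < N)%N then _ else _)).
  elim: (n) => [|m IH]; first by rewrite big_geq// mulr_ge0// mulr_ge0 ?rnorm_ge0 ?ltW.
  move: IH; rewrite subn0.
  have c0 : 0 <= K * rnorm x by rewrite mulr_ge0 ?rnorm_ge0 ?ltW.
  have aux l : (l <= N)%N -> \sum_(0 <= i < l) (if (i < N)%N then K * rnorm x else 0)
      = l%:R * (K * rnorm x).
    elim: l => [|l IH] lN; first by rewrite big_geq// mul0r.
    by rewrite big_nat_recr//= (IH (ltnW lN)) (lN : (l < N)%N = true) -natr1 mulrDl mul1r.
  move=> IH; have [mN|Nm] := leqP m.+1 N.
    by rewrite aux// ler_wpM2r// ler_nat.
  by rewrite big_nat_recr//= ltnNge -ltnS Nm addr0.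
have -> : \sum_(i < n) cutoff G alpha i *: e i =
    \sum_(i < n) cutoff G (cutoff (fun i => (i < N)%N) alpha) i *: e i +
    \sum_(i < n) cutoff G (cutoff (fun i => (N <= i)%N) alpha) i *: e i.
  rewrite -big_split; apply: eq_bigr => i _; rewrite /cutoff /=.
  by case: (G i); case: (leqP N i) => _; rewrite ?scale0r ?addr0 ?add0r.
apply: le_trans (ler_rnormD _ _) _; rewrite [leRHS]mulrDl lerD// -mulrA.
have := hC n (cutoff (fun i => (N <= i)%N) alpha) G.
move=> /(_ _)/le_trans; apply; first by move=> i; rewrite /cutoff ltnNge; case: (N <= i)%N.
rewrite ler_pM2l// mulrDl mul1r.
have -> : \sum_(i < n) cutoff (fun i => (N <= i)%N) alpha i *: e i =
    x - \sum_(i < n) cutoff predT (cutoff (fun i => (i < N)%N) alpha) i *: e i.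
  apply/eqP; rewrite -subr_eq opprK -big_split; apply/eqP/eq_bigr => i _.
  by rewrite /cutoff /=; case: (leqP N i) => _; rewrite ?scale0r ?addr0 ?add0r.
by apply: le_trans (ler_rnormB _ _) _; rewrite lerD2l low.
Qed.

End SymmetricBases.

(** * Sparse translations and Roe algebras *)

Section SparseTranslations.
Context {R : realType}.
Variables (E : completeNormedModType R[i]) (e : nat -> E).
Variables N x y : nat -> nat.
Hypotheses (N0 : N 0%N = 0%N) (N_lt : forall k, (N k < N k.+1)%N).
Hypothesis x_in : forall k, (N k <= x k < N k.+1)%N.
Hypothesis y_in : forall k, (N k <= y k < N k.+1)%N.

(** The partial translation given by the sum of the matrix units at [(x k, y k)]. *)
Definition translates (a : E -> E) : Prop :=
  [/\ bounded_operator a, forall k, a (e (y k)) = e (x k)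
    & forall n, (forall k, n <> y k) -> a (e n) = 0].

Lemma sparse_inj : injective y.
Proof. by move=> j k jk; apply: (block_uniq N_lt (y_in j)); rewrite jk. Qed.

(** As [x k] and [y k] share a block, the swaps glue to one permutation. The translation is the
    cutoff to the range of [y], bounded by unconditionality, followed by this permutation, bounded
    by symmetry. *)
Lemma sparse_translation : symmetric_basis e -> exists a, translates a.
Proof.
move=> sym_e; have [|pi bij_pi piE] :=
    glue_blocks N0 N_lt (p := fun k => swap (x k) (y k)) (q := fun k => swap (x k) (y k)).
  by move=> k; exact: swap_block_perm.
have [lambda l1 eq_pi] := (proj2 sym_e) pi bij_pi.
have l0 : 0 < lambda by exact: lt_le_trans ltr01 l1.
have [C C0 hC] := sym_unconditional sym_e.
pose Y : pred nat := fun n => `[<exists k, n = y k>].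
have [|n alpha|a ba ae] := basis_operator (proj1 sym_e) (C := lambda * C)
    (g := fun n => if Y n then e (pi n) else 0); first exact: mulr_gt0.
  have -> : \sum_(i < n) alpha i *: (if Y i then e (pi i) else 0) =
      \sum_(i < n) cutoff Y alpha i *: e (pi i).
    by apply: eq_bigr => i _; rewrite /cutoff; case: ifP => _; rewrite ?scaler0 ?scale0r.
  have [_ /le_trans] := equivalent_sums l1 eq_pi n (cutoff Y alpha); apply.
  by rewrite -mulrA ler_pM2l.
exists a; split => // [k|n nY]; rewrite ae /Y.
  by case: asboolP => [_|[]]; [rewrite (piE k)// swapr|exists k].
by case: asboolP => [[k /nY]|].
Qed.

(** Truncation at the block boundary [N k] keeps exactly the first [k] matrix units. *)
Lemma translates_partial_sum (a : E -> E) (v : E) k : translates a ->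
  a (partial_sum e (N k) v) = \sum_(j < k) coord e (y j) v *: e (x j).
Proof.
move=> [ba ay a0]; elim: k => [|k IH].
  by rewrite /partial_sum N0 !big_ord0 bop0.
rewrite big_ord_recr /= -IH /partial_sum -!(big_mkord xpredT (fun i => coord e i v *: e i)).
rewrite (big_cat_nat (leq0n (N k)) (ltnW (N_lt k))) /= (bopD ba); congr (_ + _).
rewrite (bigD1_seq (y k)) ?iota_uniq ?mem_index_iota //= (bopD ba) (bopZ ba) ay.
rewrite big_seq_cond (bop_big ba) big1 ?addr0// => i.
rewrite mem_index_iota => /andP[iN iy]; rewrite (bopZ ba) a0 ?scaler0// => j ij.
have /eqP := iy; apply; rewrite ij; congr (y _).
by apply: (block_uniq N_lt (n := i)) => //; rewrite ij.
Qed.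

End SparseTranslations.

(** * Matrix entries and rank one operators in Roe algebras *)

Section RoeAlgebra.
Context {R : realType}.
Variables (E : completeNormedModType R[i]) (e : nat -> E) (d : nat -> nat -> R).
Hypothesis sym_e : symmetric_basis e.
Hypothesis metric_d : is_metric d.
Let basis_e : schauder_basis e := proj1 sym_e.

Lemma roe_bounded a : uniform_roe_algebra d e a -> bounded_operator a.
Proof. by case. Qed.

Lemma band_roe a : band_algebra d e a -> uniform_roe_algebra d e a.
Proof.
move=> ba; split => [|eps eps0]; first by case: ba.
exists a => //; apply: le_lt_trans eps0.
apply: opnorm_le => //; first by apply: bop_sub; case: ba.
by move=> x /=; rewrite subrr rnorm0 mul0r.
Qed.

(** Band operators have no entries far from the diagonal, and an approximation in norm moves every
    entry by at most [K * A] times its error. *)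
Lemma roe_entries_vanish a : uniform_roe_algebra d e a ->
  forall eps : R, 0 < eps -> exists s : nat, forall m n, d m n > s%:R ->
    rnorm (coord e m (a (e n))) <= eps.
Proof.
move=> [ba approx] eps eps0.
have [K K0 hK] := sym_coord_bound sym_e.
have [A A0 hA] := sym_seminormalized sym_e.
have [|b [bb [r r0 br]] ab] := approx (eps / (K * A)).
  by rewrite divr_gt0 ?mulr_gt0.
exists (Num.bound r) => m n dmn.
have [_ _ d_sym _] := metric_d.
have bmn : coord e m (b (e n)) = 0.
  by apply: br; rewrite d_sym; apply: lt_trans dmn; rewrite archi_boundP// ltW.
have -> : coord e m (a (e n)) = coord e m ((a \- b) (e n)).
  by rewrite /= coordB// bmn subr0.
have bab : bounded_operator (a \- b) by exact: bop_sub.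
apply: le_trans (hK _ _) _; rewrite -ler_pdivlMl//.
apply: le_trans (opnormP bab _) _.
apply: (@le_trans _ _ (eps / (K * A) * A)).
  apply: ler_pM; [exact: opnorm_ge0|exact: rnorm_ge0|exact: ltW|].
  by have [] := hA n.
by rewrite invfM mulrA -mulrA mulVf ?gt_eqF// mulr1 mulrC.
Qed.

Definition rank_one (m : nat) (y : E) : E -> E := fun z => coord e m z *: y.

Lemma rank_one_bop m y : bounded_operator (rank_one m y).
Proof.
split => [k u v|]; first by rewrite /rank_one coordD// coordZ// scalerDl scalerA.
have [K K0 hK] := sym_coord_bound sym_e.
exists (K * rnorm y) => x; rewrite rnormZ [leRHS]mulrAC.
by rewrite ler_wpM2r ?rnorm_ge0.
Qed.

Lemma rank_one_opnorm : exists2 K : R, 0 < K &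
  forall m y, opnorm (rank_one m y) <= K * rnorm y.
Proof.
have [K K0 hK] := sym_coord_bound sym_e.
exists K => // m y; apply: opnorm_le; first exact: rank_one_bop.
  by rewrite mulr_ge0 ?rnorm_ge0 ?ltW.
by move=> x; rewrite rnormZ [leRHS]mulrAC ler_wpM2r ?rnorm_ge0.
Qed.

Lemma rank_one_e m y : rank_one m y (e m) = y.
Proof. by rewrite /rank_one coord_e// eqxx scale1r. Qed.

(** Truncating [y] leaves finitely many entries in a single column, hence a band operator. *)
Lemma rank_one_roe m y : uniform_roe_algebra d e (rank_one m y).
Proof.
have [d_ge0 _ _ _] := metric_d.
have [K K0 hK] := rank_one_opnorm.
split => [|eps eps0]; first exact: rank_one_bop.
have [|n hn] := partial_sum_tends basis_e y (eps := eps / K); first exact: divr_gt0.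
exists (rank_one m (partial_sum e n y)).
  split; first exact: rank_one_bop.
  have sum0 : 0 <= \sum_(i < n) d m i by apply: sumr_ge0.
  exists (1 + \sum_(i < n) d m i); first by rewrite ltr_pwDl.
  move=> k l dlk; rewrite /rank_one coordZ// coord_e//.
  have [ml|] := eqVneq m l; last by rewrite mul0r.
  rewrite mul1r coord_sum//; case: ifP => // kn.
  exfalso; move: dlk; rewrite -ml (bigD1 (Ordinal kn)) //=.
  have : 0 <= \sum_(i < n | i != Ordinal kn) d m i by apply: sumr_ge0.
  lra.
rewrite (_ : _ \- _ = rank_one m (y - partial_sum e n y)); last first.
  by apply/funext => z; rewrite /= /rank_one scalerBr.
apply: le_lt_trans (hK _ _) _; rewrite mulrC -ltr_pdivlMr// rdistC.
exact: hn.
Qed.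

Lemma translates_roe (x y : nat -> nat) (a : E -> E) (r : R) :
  translates e x y a -> 0 < r -> (forall k, d (x k) (y k) <= r) ->
  uniform_roe_algebra d e a.
Proof.
move=> [ba ay a0] r0 dr; apply: band_roe; split => //; exists r => // m n dnm.
have [_ _ d_sym _] := metric_d.
have [[k nk]|nY] := pselect (exists k, n = y k).
  rewrite nk ay coord_e//; case: eqP => // mx.
  by move: dnm; rewrite mx nk d_sym ltNge dr.
by rewrite a0 ?(coord0 basis_e)// => k nk; apply: nY; exists k.
Qed.

End RoeAlgebra.

(** * Entries of the images of matrix units *)

(** A cluster point would have two terms of different index within [delta / 2] of it. *)
Lemma separated_not_precompact (R : realType) (E : normedModType R[i])
    (u : nat -> E) (delta : R) (A : set E) : 0 < delta ->
  (forall j k, (j < k)%N -> delta <= rnorm (u j - u k)) ->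
  (forall k, A (u k)) -> ~ precompact A.
Proof.
move=> delta0 sep uA; rewrite precompactE => cA.
have [|p [_ clp]] := cA (u @ \oo) _.
  by exists 0%N => // k _; exact/subset_closure/uA.
pose B := [set q : E | rnorm (p - q) < delta / 2].
have nB : nbhs p B.
  apply/nbhs_ballP; exists (delta / 2)%:C%C => /=; first by rewrite ltcR divr_gt0.
  by move=> q; rewrite -ball_normE /= rnormE ltcR.
have near_p K : exists2 k, (K <= k)%N & B (u k).
  have /clp/(_ nB)[_ [[k Kk <-] Bk]] : (u @ \oo) (u @` [set k | (K <= k)%N]).
    by exists K => // k Kk; exists k.
  by exists k.
have [j _ Bj] := near_p 0%N; have [k jk Bk] := near_p j.+1.
have := sep _ _ jk; apply/negP; rewrite -ltNge.
apply: le_lt_trans (ler_rdistD p _ _) _.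
by rewrite rdistC [ltRHS]splitr ltrD.
Qed.

Lemma ball_bounded (R : realType) (d : nat -> nat -> R) (r : R) (x : nat) :
  uniformly_locally_finite d -> 0 < r ->
  exists b : nat, forall y, d x y <= r -> (y < b)%N.
Proof.
move=> ulf r0; have [n /(_ x) hn] := ulf r r0.
have fin : finite_set [set y | d x y <= r].
  exact: card_le_finite hn (finite_II n).
have /finite_seqP[s hs] := fin.
exists (\max_(i <- s) i).+1 => y dxy; rewrite ltnS.
have ys : y \in s by have : [set y | d x y <= r] y by []; rewrite hs.
by rewrite (leq_bigmax_seq _ ys).
Qed.

Section Implementation.
Context {R : realType}.
Variables (E F : completeNormedModType R[i]) (e : nat -> E) (f : nat -> F).
Variables (d d' : nat -> nat -> R).
Hypotheses (metric_d : is_metric d) (ulf_d : uniformly_locally_finite d).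
Hypothesis metric_d' : is_metric d'.
Hypotheses (sym_e : symmetric_basis e) (sym_f : symmetric_basis f).
Let basis_e : schauder_basis e := proj1 sym_e.
Let basis_f : schauder_basis f := proj1 sym_f.

Variables (U : E -> F) (V : F -> E).
Hypotheses (bop_U : bounded_operator U) (bop_V : bounded_operator V).
Hypothesis UK : cancel U V.
Hypothesis conj_roe : forall a, uniform_roe_algebra d e a ->
  uniform_roe_algebra d' f (U \o a \o V).

(* The [(m, l)] entry of the image [U E_xy V] of the matrix unit [E_xy]. *)
Definition entry (x y m l : nat) : R[i] := coord f m (U (e x)) * coord e y (V (f l)).

Lemma matrix_unit_entry x y m l :
  coord f m ((U \o rank_one e y (e x) \o V) (f l)) = entry x y m l.
Proof. by rewrite /= /rank_one (bopZ bop_U) coordZ// mulrC. Qed.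

(** Here [s] depends on [x] and [y]; [entries_equivanish] makes it uniform over [d x y <= r]. *)
Lemma entry_vanish x y (eps : R) : 0 < eps -> exists s : nat, forall m l,
  d' m l > s%:R -> rnorm (entry x y m l) <= eps.
Proof.
have roe_xy := conj_roe (rank_one_roe sym_e metric_d y (e x)).
move=> eps0; have [s hs] := roe_entries_vanish sym_f metric_d' roe_xy eps0.
by exists s => m l /hs; rewrite matrix_unit_entry.
Qed.

(** Finitely many matrix units share one bound from [entry_vanish], so bad entries far enough from
    the diagonal come from other units. Local finiteness of [d] makes both indices leave the initial
    segment. *)
Lemma entries_far_out (r eps : R) : 0 < r -> 0 < eps ->
  (forall s : nat, exists x y m l, [/\ d x y <= r, d' m l > s%:R &
     rnorm (entry x y m l) > eps]) ->
  forall N : nat, exists x y m l, [/\ (N <= x)%N, (N <= y)%N, d x y <= r,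
    d' m l > N%:R & rnorm (entry x y m l) > eps].
Proof.
move=> r0 eps0 bad N.
have [_ _ d_sym _] := metric_d.
have /choice[b hb] x := ball_bounded x ulf_d r0.
(* Every pair at distance at most [r] with one index below [N] has both indices below [N']. *)
pose N' := (N + \sum_(x < N) b x)%N.
have hN' x y : (x < N)%N -> d x y <= r -> (x < N')%N /\ (y < N')%N.
  move=> xN /hb yb; split; first by rewrite /N'; lia.
  rewrite /N' (bigD1 (Ordinal xN)) //=; lia.
have /choice[s hs] (xy : nat * nat) := entry_vanish xy.1 xy.2 eps0.
pose S := (N + \sum_(x < N') \sum_(y < N') s (x : nat, y : nat))%N.
have hS x y : (x < N')%N -> (y < N')%N -> (s (x, y) <= S)%N.
  move=> xN yN; rewrite /S (bigD1 (Ordinal xN)) //= (bigD1 (Ordinal yN)) //=; lia.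
have [x [y [m [l [dxy dml hxy]]]]] := bad S.
have not_small : ~ ((x < N')%N /\ (y < N')%N).
  move=> [xN yN]; move: hxy; apply/negP; rewrite -leNgt.
  by apply: (hs (x, y)); apply: le_lt_trans dml; rewrite ler_nat hS.
exists x, y, m, l; split => //.
- by rewrite leqNgt; apply/negP => xN; apply: not_small; exact: hN'.
- rewrite leqNgt; apply/negP => yN; apply: not_small.
  by have [] := hN' y x yN; rewrite 1?d_sym.
- by apply: le_lt_trans dml; rewrite ler_nat /S leq_addr.
Qed.

Lemma translate_image (N x y : nat -> nat) (a : E -> E) (v : E) (m k : nat) :
  N 0%N = 0%N -> (forall k, (N k < N k.+1)%N) ->
  (forall k, (N k <= y k < N k.+1)%N) -> translates e x y a ->
  coord f m (U (a (partial_sum e (N k) v))) =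
  \sum_(j < k) coord f m (U (e (x j))) * coord e (y j) v.
Proof.
move=> N0 N_lt y_in ta.
rewrite (translates_partial_sum N0 N_lt y_in v k ta) (bop_big bop_U) coord_big//.
by apply: eq_bigr => j _; rewrite (bopZ bop_U) coordZ// mulrC.
Qed.

(* Gliding hump: the sum of the matrix units of a bad sequence that escapes to
   infinity would be an operator whose image is not in the Roe algebra. *)
Theorem entries_equivanish (r eps : R) : 0 < r -> 0 < eps -> exists s : nat,
  forall x y m l, d x y <= r -> d' m l > s%:R -> rnorm (entry x y m l) <= eps.
Proof.
move=> r0 eps0; apply: contrapT => nos.
have {nos}far : forall N : nat, exists x y m l, [/\ (N <= x)%N, (N <= y)%N,
    d x y <= r, d' m l > N%:R & rnorm (entry x y m l) > eps].
  apply: (entries_far_out r0 eps0) => s; apply: contrapT => nox; apply: nos; exists s => x y m l dxy dml.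
  by rewrite leNgt; apply/negP => h; apply: nox; exists x, y, m, l.
(* The block ends so late that its unit contributes at most [eps / 8 * 2^-1 ^+ k] at all later bad
   positions, and that little of [V (f l)] lies beyond [N']. *)
pose P k N N' (t : (nat * nat) * (nat * nat)) :=
  let: ((x, y), (m, l)) := t in
  [/\ [/\ (N <= x < N')%N, (N <= y < N')%N & d x y <= r],
      d' m l > N%:R, rnorm (entry x y m l) > eps,
      forall m' l', d' m' l' > N'%:R ->
        rnorm (entry x y m' l') <= eps / 8 * 2^-1 ^+ k
    & rnorm (V (f l) - partial_sum e N' (V (f l))) <= k.+1%:R^-1].
have [|N [t [N0 NP]]] := @blocks_choice _ P.
  move=> k N; have [x [y [m [l [Nx Ny dxy dml hxy]]]]] := far N.
  have [|s hs] := entry_vanish x y (eps := eps / 8 * 2^-1 ^+ k).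
    by rewrite mulr_gt0 ?divr_gt0// exprn_gt0// invr_gt0.
  have [|M hM] := partial_sum_tends basis_e (V (f l)) (eps := k.+1%:R^-1).
    by rewrite invr_gt0.
  pose N' := (maxn x y + s + M).+1.
  exists N', ((x, y), (m, l)); split; first by rewrite /N'; lia.
  rewrite /P; split => //.
  - by split => //; rewrite ?Nx ?Ny /N'; lia.
  - by move=> m' l' h; apply: hs; apply: le_lt_trans h; rewrite ler_nat /N'; lia.
  - by rewrite rdistC ltW// hM// /N'; lia.
pose x k := (t k).1.1; pose y k := (t k).1.2.
pose m k := (t k).2.1; pose l k := (t k).2.2.
have N_lt k : (N k < N k.+1)%N by case: (NP k).
have PP k : [/\ [/\ (N k <= x k < N k.+1)%N, (N k <= y k < N k.+1)%N & d (x k) (y k) <= r],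
      d' (m k) (l k) > (N k)%:R, rnorm (entry (x k) (y k) (m k) (l k)) > eps,
      forall m' l', d' m' l' > (N k.+1)%:R ->
        rnorm (entry (x k) (y k) m' l') <= eps / 8 * 2^-1 ^+ k
    & rnorm (V (f (l k)) - partial_sum e (N k.+1) (V (f (l k)))) <= k.+1%:R^-1].
  by have [_] := NP k; rewrite /P /x /y /m /l; case: (t k) => [[? ?] [? ?]].
have x_in k : (N k <= x k < N k.+1)%N by have [[]] := PP k.
have y_in k : (N k <= y k < N k.+1)%N by have [[]] := PP k.
have [a ta] := sparse_translation N0 N_lt x_in y_in sym_e.
have [ba _ _] := ta.
have roe_a : uniform_roe_algebra d e a.
  by apply: translates_roe ta r0 _ => // k; have [[]] := PP k.
have [|s hs] := roe_entries_vanish sym_f metric_d' (conj_roe roe_a) (eps := eps / 4).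
  by rewrite divr_gt0.
have [K K0 hK] := sym_coord_bound sym_f.
have [M M0 hM] := bop_bound (bop_comp bop_U ba).
(* The first summand puts the bad entry where the image of [a] is at most [eps / 4]; the second
   brings the tail error [K * M / k.+1] below [eps / 4]. *)
pose k := (s + Num.bound (4 * (K * M) / eps))%N.
have [_ dml big_entry _ tail_small] := PP k.
have KM0 : 0 < K * M by rewrite mulr_gt0.
have : rnorm (coord f (m k) ((U \o a \o V) (f (l k)))) <= eps / 4.
  apply: hs; apply: le_lt_trans dml; rewrite ler_nat.
  by apply: leq_trans (block_ge N_lt k); rewrite /k leq_addr.
move: tail_small; rewrite /=; set v := V (f (l k)) => tail_small.
(* The entry splits into earlier units [h], the bad unit [z] and the tail [c]. The total, [h] and
   [c] are each at most [eps / 4], which contradicts the size of [z]. *)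
pose w := v - partial_sum e (N k.+1) v.
have -> : U (a v) = U (a (partial_sum e (N k.+1) v)) + U (a w).
  by rewrite -(bopD bop_U) -(bopD ba) /w addrC subrK.
rewrite coordD// (translate_image v (m k) k.+1 N0 N_lt y_in ta) big_ord_recr /=.
rewrite -/(entry (x k) (y k) (m k) (l k)).
set z := entry _ _ _ _ in big_entry *; set h := \sum_(j < k) _; set c := coord _ _ _.
have h_small : rnorm h <= eps / 4.
  apply: le_trans (ler_rnorm_sum _ _ _) _.
  apply: (@le_trans _ _ (\sum_(j < k) eps / 8 * 2^-1 ^+ j)).
    apply: ler_sum => j _; have [_ _ _ + _] := PP j; apply.
    by apply: le_lt_trans dml; rewrite ler_nat; apply: block_le.
  rewrite -mulr_sumr -(big_mkord xpredT (fun j => 2^-1 ^+ j)).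
  have := @sum_half_pow R _ _ (leq0n k); rewrite expr0 mulr1 => hp.
  have e8 : 0 <= eps / 8 by rewrite divr_ge0// ltW.
  by have := ler_wpM2l e8 hp; lra.
have c_small : rnorm c <= eps / 4.
  apply: le_trans (hK _ _) _; apply: (@le_trans _ _ (K * (M * k.+1%:R^-1))).
    rewrite ler_pM2l//; apply: le_trans (hM _) _.
    by rewrite ler_pM2l.
  rewrite mulrA ler_pdivrMr// -ler_pdivrMl ?divr_gt0//.
  have q0 : 0 < 4 * (K * M) / eps by rewrite divr_gt0// mulr_gt0.
  have hb := archi_boundP (ltW q0).
  have -> : (eps / 4)^-1 * (K * M) = 4 * (K * M) / eps.
    by field; rewrite gt_eqF.
  apply: le_trans (ltW hb) _; rewrite ler_nat /k; lia.
have : rnorm z <= rnorm (h + z + c) + rnorm h + rnorm c.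
  have zE : z = h + z + c - h - c.
    by rewrite -!addrA (addrCA c) subrr addr0 addrC subrK.
  rewrite {1}zE; apply: le_trans (ler_rnormB _ _) _.
  by rewrite lerD2r; exact: ler_rnormB.
lra.
Qed.

(** Both [U (e n)] and the functional [coord e n] after [V] are nonzero. The latter is packaged as a
    rank one operator so that [bop_ext] applies. *)
Lemma entry_diag_neq0 n : exists m l, entry n n m l != 0.
Proof.
have /existsNP[m] : ~ forall m, coord f m (U (e n)) = 0.
  move=> h; have : U (e n) = U 0.
    by apply: (coord_ext basis_f) => m; rewrite h (bop0 bop_U) coord0.
  by move=> /(can_inj UK)/eqP; rewrite (negbTE (basis_neq0 basis_e n)).
move=> /eqP m0.
have /existsNP[l] : ~ forall l, coord e n (V (f l)) = 0.
  move=> h; have : rank_one e n (e n) \o V = (fun=> 0).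
    apply: (bop_ext basis_f) => [||l].
    - exact: bop_comp (rank_one_bop sym_e _ _) bop_V.
    - by split=> [k u v|]; [rewrite scaler0 addr0|exists 0 => ?; rewrite rnorm0 mul0r].
    - by rewrite /= /rank_one h scale0r.
  move=> /(congr1 (fun g => g (U (e n)))) /=; rewrite UK rank_one_e//.
  by move=> /eqP; rewrite (negbTE (basis_neq0 basis_e n)).
by move=> /eqP l0; exists m, l; rewrite mulf_neq0.
Qed.

Lemma entry_diag_finite N : exists2 delta : R, 0 < delta &
  forall n, (n < N)%N -> exists m l, delta < rnorm (entry n n m l).
Proof.
elim: N => [|N [delta delta0 IH]]; first by exists 1.
have [m [l /rnorm_gt0 ml]] := entry_diag_neq0 N.
exists (Num.min delta (rnorm (entry N N m l) / 2)) => [|n].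
  by rewrite lt_min delta0 divr_gt0.
rewrite ltnS leq_eqVlt => /predU1P[->|nN].
  by exists m, l; rewrite gt_min; apply/orP; right; lra.
by have [m' [l' h]] := IH n nN; exists m', l'; rewrite gt_min h.
Qed.

Lemma coord_vanish (y : F) (eps : R) : 0 < eps ->
  exists m0, forall m, (m0 <= m)%N -> rnorm (coord f m y) <= eps.
Proof.
move=> eps0; have [A A0 hA] := sym_seminormalized sym_f.
have [|m0 hm0] := tends_rcauchy (partial_sum_tends basis_f y) (eps := eps / A).
  exact: divr_gt0.
exists m0 => m mm0; have [_ hm] := hA m.
apply: (@le_trans _ _ (rnorm (coord f m y) * (A * rnorm (f m)))).
  by rewrite ler_peMr ?rnorm_ge0.
rewrite mulrCA -rnormZ -ler_pdivlMl// mulrC ltW//.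
have -> : coord f m y *: f m = partial_sum f m.+1 y - partial_sum f m y.
  by rewrite /partial_sum big_ord_recr /= [in RHS]addrC addrK.
by apply: hm0 => //; exact: leqW.
Qed.

Hypothesis ghost_compact : forall b, uniform_roe_algebra d' f b ->
  ghost_idempotent f b -> compact_operator b.

(* Otherwise a sparse set of indices gives a diagonal idempotent of infinite
   rank whose image is a ghost. *)
Theorem entry_diag_large : exists2 delta : R, 0 < delta &
  forall n, exists m l, delta < rnorm (entry n n m l).
Proof.
apply: contrapT => nodelta.
have [|N [n [N0 NP]]] := @blocks_choice nat (fun k N N' n => (N <= n < N')%N /\
    forall m l, rnorm (entry n n m l) <= 2^-1 ^+ k).
  move=> k N; have [delta delta0 hdelta] := entry_diag_finite N.
  have h2 : 0 < 2^-1 ^+ k :> R by rewrite exprn_gt0// invr_gt0.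
  (* Including [delta], which serves all indices below [N], forces the new index to be at least
     [N]. *)
  have min0 : 0 < Num.min delta (2^-1 ^+ k) by rewrite lt_min delta0.
  have /existsNP[n hn] : ~ forall n, exists m l,
      Num.min delta (2^-1 ^+ k) < rnorm (entry n n m l).
    by move=> h; apply: nodelta; exists (Num.min delta (2^-1 ^+ k)).
  have Nn : (N <= n)%N.
    rewrite leqNgt; apply/negP => /hdelta[m [l ml]]; apply: hn; exists m, l.
    by rewrite gt_min ml.
  exists n.+1, n; split; first by rewrite ltnS.
  split; first by rewrite Nn /=.
  move=> m l; rewrite leNgt; apply/negP => ml; apply: hn; exists m, l.
  by rewrite gt_min ml orbT.
have N_lt k : (N k < N k.+1)%N by case: (NP k).
have n_in k : (N k <= n k < N k.+1)%N by case: (NP k) => _ [].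
have n_small k m l : rnorm (entry (n k) (n k) m l) <= 2^-1 ^+ k.
  by case: (NP k) => _ [_].
(* With both sequences equal to [n], the translation is a diagonal idempotent. *)
have [a ta] := sparse_translation N0 N_lt n_in n_in sym_e.
have [ba an a0] := ta.
have [_ d_refl _ _] := metric_d.
have roe_a : uniform_roe_algebra d e a.
  apply: translates_roe ta ltr01 _ => // k.
  by rewrite (proj2 (d_refl _ _) erefl).
have aa : a \o a = a.
  apply: (bop_ext basis_e) => [||i]; [exact: bop_comp|exact: ba|].
  have [[k ->]|nk] := pselect (exists k, i = n k); first by rewrite /= !an.
  by rewrite /= a0 ?(bop0 ba)// => k ik; apply: nk; exists k.
set b := U \o a \o V; have roe_b : uniform_roe_algebra d' f b by exact: conj_roe.
have bb : b \o b = b.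
  by apply/funext => z; rewrite /b /= UK; congr U; exact: (congr1 (fun g => g (V z)) aa).
have [K K0 hK] := sym_coord_bound sym_e.
have [A A0 hA] := sym_seminormalized sym_f.
have [MV MV0 hMV] := bop_bound bop_V.
have ghost_b : ghost f b.
  split => [|eps eps0]; first exact: roe_bounded roe_b.
  (* Units from [k0] on contribute at most [2 * 2^-1 ^+ k0], less than [eps / 2]. The first [k0]
     units contribute at most [eps / 2] for large [m], uniformly in [l], as [B] bounds their second
     factors. *)
  have [|k0 hk0] := half_pow_lt (eps := eps / 4); first exact: divr_gt0.
  pose B := K * (MV * A).
  have B0 : 0 < B by rewrite !mulr_gt0.
  pose eps' := eps / (2 * k0.+1%:R * B).
  have eps'0 : 0 < eps' by rewrite divr_gt0// !mulr_gt0.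
  have /choice[m0 hm0] j : exists m0, forall m, (m0 <= m)%N ->
      rnorm (coord f m (U (e (n j)))) <= eps' by exact: coord_vanish.
  exists (\sum_(j < k0) m0 j)%N => m l mm0 _.
  have head : \sum_(0 <= j < k0) rnorm (entry (n j) (n j) m l) <= eps / 2.
    apply: (@le_trans _ _ (\sum_(0 <= j < k0) eps' * B)).
      rewrite !big_mkord; apply: ler_sum => j _; rewrite rnormM.
      apply: ler_pM; rewrite ?rnorm_ge0//.
        by apply: hm0; apply: leq_trans mm0; rewrite (bigD1 j) //= leq_addr.
      apply: le_trans (hK _ _) _; rewrite ler_pM2l//.
      by apply: le_trans (hMV _) _; rewrite ler_pM2l//; have [] := hA l.
    rewrite sumr_const_nat subn0 -[leLHS]mulr_natr.
    have -> : eps' * B * k0%:R = eps / 2 * (k0%:R / k0.+1%:R).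
      by rewrite /eps'; field; rewrite !gt_eqF ?ltr0n//=.
    by rewrite ler_piMr ?divr_ge0 ?(ltW eps0)// ler_pdivrMr// mul1r ler_nat.
  have part k : rnorm (coord f m (U (a (partial_sum e (N (k0 + k)%N) (V (f l)))))) <= eps.
    rewrite (translate_image _ m _ N0 N_lt n_in ta).
    apply: le_trans (ler_rnorm_sum _ _ _) _.
    rewrite -(big_mkord xpredT (fun j => rnorm (entry (n j) (n j) m l))).
    rewrite (big_cat_nat (leq0n k0) (leq_addr k k0)) /=.
    have : \sum_(k0 <= j < k0 + k) rnorm (entry (n j) (n j) m l) <= 2 * 2^-1 ^+ k0.
      apply: le_trans (sum_half_pow (leq_addr k k0)).
      by apply: ler_sum => j _; exact: n_small.
    move: head hk0; lra.
  have fm0 : 0 < rnorm (f m) by exact: basis_gt0.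
  rewrite -(ler_pM2r fm0) -rnormZ.
  (* The coordinate becomes a bounded operator, so the bounds [part] pass to the limit along the
     block ends. *)
  pose c := rank_one f m (f m) \o (U \o a).
  have bc : bounded_operator c.
    by apply: bop_comp; [exact: rank_one_bop|exact: bop_comp].
  apply: (@tends_le _ _ (fun k => c (partial_sum e (N (k0 + k)%N) (V (f l))))).
    move=> del del0; have [M hM] := bop_tends bc (partial_sum_tends basis_e (V (f l))) del0.
    exists M => k Mk; apply: hM; apply: leq_trans (block_ge N_lt _).
    exact: leq_trans Mk (leq_addl _ _).
  by move=> k; rewrite /c /rank_one /= rnormZ ler_pM2r.
have [_] := ghost_compact roe_b (conj ghost_b bb).
have [MU MU0 hMU] := bop_bound bop_U.
have [A' A'0 hA'] := sym_seminormalized sym_e.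
(* Dividing by [M] puts the vectors [U (e (n k))] in the unit ball. They are fixed by [b], and
   coordinate [n j] after [V] separates them. *)
pose M := MU * A'; have M0 : 0 < M by rewrite mulr_gt0.
pose c : R[i] := M^-1%:C%C.
have c_norm : rnorm c = M^-1 by rewrite rnorm_real gtr0_norm ?invr_gt0.
apply: (@separated_not_precompact _ _ (fun k => c *: U (e (n k))) ((K * MV * M)^-1)).
- by rewrite invr_gt0 !mulr_gt0.
- move=> j k jk; rewrite -scalerBr rnormZ c_norm invfM mulrC ler_pM2l ?invr_gt0//.
  rewrite -(bopB bop_U) -div1r ler_pdivrMr ?mulr_gt0//.
  have njk : n j != n k.
    by apply/eqP => /(sparse_inj N_lt n_in) jkE; rewrite jkE ltnn in jk.
  have h : 1 <= K * rnorm (V (U (e (n j) - e (n k)))).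
    have := hK (n j) (e (n j) - e (n k)).
    by rewrite UK coordB// !coord_e// eqxx (negbTE njk) subr0 rnorm1.
  apply: le_trans h _; rewrite [leRHS]mulrC -mulrA ler_pM2l//.
- move=> k; exists (c *: U (e (n k))) => /=.
    rewrite rnormZ c_norm mulrC ler_pdivrMr// mul1r.
    by apply: le_trans (hMU _) _; rewrite ler_pM2l//; have [] := hA' (n k).
  by rewrite /b /= (bopZ bop_V) UK (bopZ ba) an (bopZ bop_U).
Qed.

End Implementation.

(** * Rigidity *)

Section LargeEntries.
Context {R : realType}.
Variables (E F : completeNormedModType R[i]) (e : nat -> E) (f : nat -> F).
Variables (d d' : nat -> nat -> R).
Hypotheses (metric_d : is_metric d) (ulf_d : uniformly_locally_finite d).
Hypothesis metric_d' : is_metric d'.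
Hypotheses (sym_e : symmetric_basis e) (sym_f : symmetric_basis f).
Variables (U : E -> F) (V : F -> E).
Hypotheses (bop_U : bounded_operator U) (bop_V : bounded_operator V).
Hypothesis UK : cancel U V.
Hypothesis conj_roe : forall a, uniform_roe_algebra d e a ->
  uniform_roe_algebra d' f (U \o a \o V).

(** The corresponding entry is at least [delta * delta], above the threshold [delta * delta / 2]
    given to [entries_equivanish]. *)
Lemma large_entries_close (r delta : R) : 0 < r -> 0 < delta ->
  exists s : nat, forall x y m l, d x y <= r ->
    delta <= rnorm (coord f m (U (e x))) ->
    delta <= rnorm (coord e y (V (f l))) -> d' m l <= s%:R.
Proof.
move=> r0 delta0; have h0 : 0 < delta * delta / 2 by rewrite divr_gt0// mulr_gt0.
have [s hs] := entries_equivanish metric_d ulf_d metric_d' sym_e sym_f bop_U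
  conj_roe r0 h0.
exists s => x y m l dxy hm hl; rewrite leNgt; apply/negP => dml.
have := hs _ _ _ _ dxy dml; rewrite /entry rnormM.
have := ler_pM (ltW delta0) (ltW delta0) hm hl.
have : 0 < delta * delta by rewrite mulr_gt0.
lra.
Qed.

Hypothesis ghost_compact : forall b, uniform_roe_algebra d' f b ->
  ghost_idempotent f b -> compact_operator b.

(** Both factors of an entry are uniformly bounded, so a lower bound for the product passes to each
    factor. *)
Lemma large_entries : exists (delta : R) (phi psi : nat -> nat), 0 < delta /\
  forall n, delta <= rnorm (coord f (phi n) (U (e n))) /\
    delta <= rnorm (coord e n (V (f (psi n)))).
Proof.
have [delta delta0 large] := entry_diag_large metric_d sym_e sym_f bop_U
  bop_V UK conj_roe ghost_compact.
have /choice[ml hml] n : exists ml : nat * nat, delta < rnorm (entry e f U V n n ml.1 ml.2).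
  by have [m [l h]] := large n; exists (m, l).
have bound (A B : completeNormedModType R[i]) (a : nat -> A) (b : nat -> B) (T : A -> B) :
    symmetric_basis a -> symmetric_basis b -> bounded_operator T ->
    exists2 M : R, 0 < M & forall m n, rnorm (coord b m (T (a n))) <= M.
  move=> sym_a sym_b bop_T.
  have [K K0 hK] := sym_coord_bound sym_b.
  have [C C0 hC] := sym_seminormalized sym_a.
  have [M M0 hM] := bop_bound bop_T.
  exists (K * (M * C)) => [|m n]; first by rewrite !mulr_gt0.
  apply: le_trans (hK _ _) _; rewrite ler_pM2l//; apply: le_trans (hM _) _.
  by rewrite ler_pM2l//; have [] := hC n.
have [M M0 hM] := bound _ _ _ _ _ sym_e sym_f bop_U.
have [L L0 hL] := bound _ _ _ _ _ sym_f sym_e bop_V.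
exists (delta / (M + L)), (fun n => (ml n).1), (fun n => (ml n).2).
split=> [|n]; first by rewrite divr_gt0// addr_gt0.
have := hml n; rewrite /entry rnormM.
set s := rnorm _; set t := rnorm _ => st.
have s0 : 0 <= s := rnorm_ge0 _; have t0 : 0 <= t := rnorm_ge0 _.
have sM : s <= M by exact: hM.
have tL : t <= L by exact: hL.
by rewrite !ler_pdivrMr ?addr_gt0//; split; nra.
Qed.

(** When [d x y < r], the point [psi y] is close to both [phi x] and [phi y]. *)
Lemma coarse_of_large_entries (delta : R) (phi psi : nat -> nat) : 0 < delta ->
  (forall n, delta <= rnorm (coord f (phi n) (U (e n))) /\
     delta <= rnorm (coord e n (V (f (psi n))))) ->
  coarse d d' phi.
Proof.
move=> delta0 large r r0; have [s hs] := large_entries_close r0 delta0.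
have [_ d_refl _ _] := metric_d; have [_ _ d'_sym d'_tri] := metric_d'.
exists (s%:R + s%:R + 1) => [|x y dxy]; first by rewrite ltr_wpDl// addr_ge0.
have close_xy : d' (phi x) (psi y) <= s%:R.
  by apply: (hs x y) => //; [exact: ltW|have [] := large x|have [] := large y].
have close_yy : d' (phi y) (psi y) <= s%:R.
  apply: (hs y y) => //; [|by have [] := large y|by have [] := large y].
  by rewrite (proj2 (d_refl y y) erefl) ltW.
have := d'_tri (phi x) (psi y) (phi y); rewrite (d'_sym (psi y)); lra.
Qed.

End LargeEntries.

Lemma coarse_equivalence_of_inverse (R : realType) (X Y : Type)
    (d : X -> X -> R) (d' : Y -> Y -> R) (f : X -> Y) (g : Y -> X) (c : R) :
  is_metric d -> is_metric d' -> coarse d d' f -> coarse d' d g ->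
  (forall x, d (g (f x)) x <= c) -> (forall y, d' (f (g y)) y <= c) ->
  coarse_equivalence d d' f.
Proof.
move=> [d_ge0 _ d_sym d_tri] [d'_ge0 _ d'_sym _] coarse_f coarse_g gf fg.
split; first split => // s s0.
  (* [s + 1] turns the bound [<= s] into the strict one that coarseness expects. *)
  have [|t t0 ht] := coarse_g (s + 1); first by rewrite addr_gt0.
  exists (Num.max 1 (c + t + c)) => [|x y]; first by rewrite lt_max ltr01.
  rewrite gt_max => /andP[_ dxy]; rewrite ltNge; apply/negP => fxy.
  have gt : d (g (f x)) (g (f y)) < t by apply: ht; lra.
  have := d_tri x (g (f x)) y; have := d_tri (g (f x)) (g (f y)) y.
  have := gf x; have := gf y; rewrite (d_sym x (g (f x))); lra.
exists c => _ [y _ <-]; apply: le_trans (fg y); rewrite d'_sym.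
apply: ge_inf; last by exists (f (g y)) => //; exists (g y).
by exists 0 => _ [z _ <-].
Qed.

(** * Spatial implementation of algebra isomorphisms *)

Section SpatialImplementation.
Context {R : realType}.
Variables (E F : completeNormedModType R[i]) (e : nat -> E) (f : nat -> F).
Variables (d d' : nat -> nat -> R).
Hypotheses (metric_d : is_metric d) (metric_d' : is_metric d').
Hypotheses (sym_e : symmetric_basis e) (sym_f : symmetric_basis f).
Let basis_e : schauder_basis e := proj1 sym_e.
Let basis_f : schauder_basis f := proj1 sym_f.

(* Fix a vector [y0] in the range of the image of the idempotent
   [rank_one e 0 (e 0)]; the implementing operator is
   [U x = Phi (rank_one e 0 x) y0], which intertwines [a] and [Phi a]. *)
Theorem iso_spatial (Phi : (E -> E) -> (F -> F)) :
  banach_algebra_iso (uniform_roe_algebra d e) (uniform_roe_algebra d' f) Phi ->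
  exists (U : E -> F) (V : F -> E), [/\ bounded_operator U, bounded_operator V,
    cancel U V, cancel V U
    & forall a, uniform_roe_algebra d e a -> Phi a = U \o a \o V].
Proof.
move=> [[homPhi injPhi surjPhi] [PhiD PhiZ PhiM] [C hC] [C' hC']].
have r1 m (x : E) := rank_one_roe sym_e metric_d m x.
have [K K0 hK] := rank_one_opnorm sym_e.
have [L L0 hL] := rank_one_opnorm sym_f.
have rank_oneD (x y : E) k : rank_one e 0 (k *: x + y) =
    (k \*: rank_one e 0 x) \+ rank_one e 0 y.
  by apply/funext => z; rewrite /rank_one /= scalerDr !scalerA mulrC.
have rank_oneZ (x : E) k : rank_one e 0 (k *: x) = k \*: rank_one e 0 x.
  by apply/funext => z; rewrite /rank_one /= !scalerA mulrC.
pose p := rank_one e 0 (e 0%N); pose q := Phi p.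
have pp : p \o p = p.
  by apply/funext => z; rewrite /p /= {1}/rank_one /rank_one coordZ// coord_e// eqxx mulr1.
have qq z : q (q z) = q z by rewrite -[in RHS]/(q z) /q -[in RHS]pp PhiM//; exact: r1.
(* If [q] vanished, [p] and the zero operator would have the same image under the injective
   [Phi]. *)
have [z qz] : exists z, q z != 0.
  apply: contrapT => noz.
  have q0 : 0 \*: q = q.
    apply/funext => z /=; rewrite scale0r; apply/esym/eqP.
    by apply: contrapT => /negP qz; apply: noz; exists z.
  have : rank_one e 0 0 = p.
    apply: injPhi; rewrite ?inE; [exact: r1|exact: r1|].
    by rewrite -[X in rank_one e 0 X](scale0r (e 0%N)) rank_oneZ PhiZ//; exact: r1.
  move=> /(congr1 (fun g => g (e 0%N))); rewrite /p !rank_one_e// => /esym/eqP.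
  by rewrite (negbTE (basis_neq0 basis_e 0)).
pose y0 := q z; have qy0 : q y0 = y0 := qq z.
have [m /eqP cm0] : exists m, coord f m y0 <> 0.
  apply: contrapT => nom; move: qz; apply/negP; rewrite negbK; apply/eqP.
  apply: (coord_ext basis_f) => m; rewrite coord0//.
  by apply: contrapT => hm; apply: nom; exists m.
pose U x := Phi (rank_one e 0 x) y0.
have bPhi a : uniform_roe_algebra d e a -> bounded_operator (Phi a).
  by move=> /homPhi/roe_bounded.
have U_bound x : rnorm (U x) <= `|C| * K * rnorm y0 * rnorm x.
  apply: le_trans (opnormP (bPhi _ (r1 _ _)) _) _.
  rewrite [leRHS]mulrAC ler_wpM2r ?rnorm_ge0//.
  apply: le_trans (hC _ (r1 _ _)) _.
  apply: (@le_trans _ _ (`|C| * opnorm (rank_one e 0 x))).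
    by rewrite ler_wpM2r ?ler_norm//; exact/opnorm_ge0/rank_one_bop.
  by rewrite -mulrA ler_wpM2l.
have bop_U : bounded_operator U.
  split; last by exists (`|C| * K * rnorm y0).
  move=> k x y; rewrite /U rank_oneD PhiD; last exact: r1.
    by rewrite PhiZ//; exact: r1.
  by rewrite -rank_oneZ; exact: r1.
(* Composing [a] with the rank one operator of [x] gives that of [a x], and [Phi] is
   multiplicative. *)
have intertwine a x : uniform_roe_algebra d e a -> U (a x) = Phi a (U x).
  move=> Aa; rewrite /U (_ : rank_one e 0 (a x) = a \o rank_one e 0 x).
    by rewrite PhiM//; exact: r1.
  by apply/funext => y; rewrite /rank_one /= (bopZ (roe_bounded Aa)).
have Ue0 : U (e 0%N) = y0 by [].
(* By intertwining, [U (Psi y (e 0))] is [coord f m y0 *: y]; hence the division by [c] in [V]. *)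
have /choice[Psi PsiP] y : exists a, uniform_roe_algebra d e a /\ Phi a = rank_one f m y.
  by have [a Aa <-] := surjPhi _ (rank_one_roe sym_f metric_d' m y); exists a.
pose c := coord f m y0.
pose V y := c^-1 *: Psi y (e 0%N).
have UV : cancel V U.
  move=> y; have [APsi PhiPsi] := PsiP y.
  by rewrite /V (bopZ bop_U) intertwine// PhiPsi Ue0 /rank_one scalerA mulVf// scale1r.
(* A nonzero coordinate [k] of [x] lets [rank_one e k (e 0)] send [x] to a nonzero multiple of
   [e 0], on which [U] does not vanish. *)
have U_inj x : U x = 0 -> x = 0.
  move=> Ux; apply: (coord_ext basis_e) => k; rewrite coord0//.
  apply/eqP; apply: contrapT => /negP xk.
  have := intertwine (rank_one e k (e 0%N)) x (r1 _ _).
  rewrite Ux (bop0 (bPhi _ (r1 _ _))) /rank_one (bopZ bop_U) Ue0 => /eqP.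
  by rewrite scaler_eq0 (negbTE xk) (negbTE qz).
have VU : cancel U V.
  by move=> x; apply/eqP; rewrite -subr_eq0; apply/eqP/U_inj; rewrite (bopB bop_U) UV subrr.
exists U, V; split => //.
  split => [k x y|].
    by apply: (can_inj VU); rewrite UV (bopD bop_U) (bopZ bop_U) !UV.
  exists (rnorm c^-1 * (`|C'| * L * rnorm (e 0%N))) => y.
  have [APsi PhiPsi] := PsiP y.
  rewrite /V rnormZ -mulrA ler_wpM2l ?rnorm_ge0//.
  apply: le_trans (opnormP (roe_bounded APsi) _) _.
  rewrite [leRHS]mulrAC ler_wpM2r ?rnorm_ge0//.
  apply: le_trans (hC' _ APsi) _; rewrite PhiPsi.
  apply: (@le_trans _ _ (`|C'| * opnorm (rank_one f m y))).
    by rewrite ler_wpM2r ?ler_norm//; exact/opnorm_ge0/rank_one_bop.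
  by rewrite -mulrA ler_wpM2l.
by move=> a Aa; apply/funext => y /=; rewrite intertwine// UV.
Qed.

End SpatialImplementation.

Theorem theorem1p4 (R : realType) (d d' : nat -> nat -> R)
  (E F : completeNormedModType R[i]) (e : nat -> E) (f : nat -> F)
  (d_metric : is_metric d) (d_ulf : uniformly_locally_finite d)
  (d'_metric : is_metric d') (d'_ulf : uniformly_locally_finite d')
  (e_sym : symmetric_basis e) (f_sym : symmetric_basis f)
  (ghostE : forall a, uniform_roe_algebra d e a -> ghost_idempotent e a ->
     compact_operator a)
  (ghostF : forall a, uniform_roe_algebra d' f a -> ghost_idempotent f a ->
     compact_operator a)
  (iso : banach_algebra_isomorphic (uniform_roe_algebra d e)
     (uniform_roe_algebra d' f)) :
  coarsely_equivalent d d'.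
Proof.
have [Phi isoPhi] := iso.
have [U [V [bop_U bop_V UK VK PhiE]]] := iso_spatial d_metric d'_metric e_sym f_sym isoPhi.
have [[homPhi _ surjPhi] _ _ _] := isoPhi.
have conjU a : uniform_roe_algebra d e a -> uniform_roe_algebra d' f (U \o a \o V).
  by move=> Aa; rewrite -PhiE//; exact: homPhi.
have conjV b : uniform_roe_algebra d' f b -> uniform_roe_algebra d e (V \o b \o U).
  move=> /surjPhi[a Aa <-]; rewrite PhiE// (_ : V \o _ \o U = a)//.
  by apply/funext => x /=; rewrite !UK.
have [delta [phi [psi [delta0 large]]]] := large_entries d_metric
  e_sym f_sym bop_U bop_V UK conjU ghostF.
have [delta' [phi' [psi' [delta'0 large']]]] := large_entries d'_metric
  f_sym e_sym bop_V bop_U VK conjV ghostE.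
pose eps := Num.min delta delta'.
have eps0 : 0 < eps by rewrite lt_min delta0.
have eps_l : eps <= delta by rewrite ge_min lexx.
have eps_r : eps <= delta' by rewrite ge_min lexx orbT.
have [s hs] := large_entries_close d_metric d_ulf d'_metric e_sym f_sym bop_U
  conjU ltr01 eps0.
have [s' hs'] := large_entries_close d'_metric d'_ulf d_metric f_sym e_sym bop_V
  conjV ltr01 eps0.
have d_refl x : d x x <= 1.
  by case: d_metric => _ /(_ x x)[_ ->].
have d'_refl x : d' x x <= 1.
  by case: d'_metric => _ /(_ x x)[_ ->].
exists phi; apply: (@coarse_equivalence_of_inverse _ _ _ _ _ phi phi' (s + s')%:R) => //.
- exact: coarse_of_large_entries delta0 large.
- exact: coarse_of_large_entries delta'0 large'.
(* The image of the matrix unit at [(phi x, phi x)] under the inverse isomorphism has a large entry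
   at [(phi' (phi x), x)], so these two points are close. *)
- move=> x; apply: (@le_trans _ _ s'%:R); last by rewrite ler_nat leq_addl.
  apply: (hs' (phi x) (phi x)) => //.
    by apply: le_trans eps_r _; have [] := large' (phi x).
  by apply: le_trans eps_l _; have [] := large x.
- move=> y; apply: (@le_trans _ _ s%:R); last by rewrite ler_nat leq_addr.
  apply: (hs (phi' y) (phi' y)) => //.
    by apply: le_trans eps_l _; have [] := large (phi' y).
  by apply: le_trans eps_r _; have [] := large' y.
Qed.
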